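(* Let $\mathcal V$ be a finitely generated pseudovariety of minimal Taylor algebras, and for each $\mathbf A\in\mathcal V$ let $as(\mathbf A)=(A;\rightarrow_{as}^Z)$ and $sm(\mathbf A)=(A;\rightarrow_{sm}^Z)$ be the digraphs defined as follows, for $a,b\in A$: (1) $a\rightarrow_{as}^Z b$ iff for every cyclic term $c(x_1,\dots,x_n)$ of $\mathcal V$, $b\in\mathrm{Sg}(a,c(a,a,\dots,a,b))$; (2) $a\rightarrow_{sm}^Z b$ iff for every binary term $t(x,y)$, every cyclic term $c(x_1,\dots,x_n)$ of $\mathcal V$ and every integer $k>0$ with $k\le n/2$, $b\in\mathrm{Sg}\bigl(a,\,t\bigl(b,\,c(\underbrace{a,\dots,a}_{k},\underbrace{b,\dots,b}_{n-k})\bigr)\bigr)$. Then $\{(\mathbf A,as(\mathbf A),sm(\mathbf A)):\mathbf A\in\mathcal V\}$ satisfies the Edge Axioms.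
   Context: All algebras are finite and idempotent. $\mathrm{Sg}(X)$ is the subuniverse generated by $X$ (a subuniverse is a subset closed under the operations). A Taylor term is an idempotent term satisfying a finite set of equations not satisfied by any projection on a set with more than one element. A finite algebra $\mathbf A$ is minimal Taylor if it has a Taylor term and each Taylor term operation of $\mathbf A$ generates the whole clone of term operations of $\mathbf A$. A finitely generated pseudovariety of minimal Taylor algebras is a class $\mathcal V=\mathsf{HSP}_{fin}(\mathbf A)$ (homomorphic images of subalgebras of finite powers) for a single finite minimal Taylor algebra $\mathbf A$; all its members are minimal Taylor. An algebra is affine if its clone of polynomial operations equals that of some left module over some ring with the same universe. A cyclic term of $\mathcal V$ is a term $c(x_1,\dots,x_n)$ such that $c(x,\dots,x)\approx x$ and $c(x_1,x_2,\dots,x_n)\approx c(x_2,\dots,x_n,x_1)$ hold in all algebras of $\mathcal V$. **Edge Axioms** for a class assigning to each $\mathbf A\in\mathcal V$ digraphs $as(\mathbf A)=(A;\rightarrow_{as})$, $sm(\mathbf A)=(A;\rightarrow_{sm})$, where $\rightarrow_s:=\rightarrow_{as}\cap\rightarrow_{sm}$. For all $\mathbf A,\mathbf B,\mathbf C\in\mathcal V$: - Base 1: if $\mathbf B\le\mathbf A$ is affine, then $a\rightarrow_{as}b$ in $\mathbf A$ for all $a,b\in B$. - Base 2: if $\mathbf B\le\mathbf A$ has a majority term, then $a\rightarrow_{sm}b$ in $\mathbf A$ for all $a,b\in B$. - Base 3: if $a,b\in A$ and some term $t(x,y)$ acts on $\{a,b\}$ as a semilattice operation with absorbing element $b$, then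 $a\rightarrow_s b$. - Homomorphism 1: if $f:\mathbf A\to\mathbf B$ is a homomorphism, $a\rightarrow_{as}b$ in $\mathbf A$ implies $f(a)\rightarrow_{as}f(b)$ in $\mathbf B$, and likewise for $\rightarrow_{sm}$. - Homomorphism 2: let $f:\mathbf A\to\mathbf B$ be a homomorphism, $a,b\in A$, and $x\in\{as,sm,s\}$. If $f(a)\rightarrow_x f(b)$ in $\mathbf B$, then $a\rightarrow_x b'$ in $\mathbf A$ for every $b'\in A$ such that $f(b')=f(b)$ and $\mathrm{Sg}(\{a,b'\})$ is minimal (under inclusion) among $\{\mathrm{Sg}(\{a,c\}):c\in A,\ f(c)=f(b)\}$. - Relational 1: if $R\le\mathbf A\times\mathbf B$, $a_1\rightarrow_{as}a_2$ in $\mathbf A$, $b_1\rightarrow_{sm}b_2$ in $\mathbf B$, and $(a_1,b_2),(a_2,b_1)\in R$, then $(a_2,b_2)\in R$. - Relational 2: if $R\le\mathbf A\times\mathbf B$, $a_1\rightarrow_{as}a_2$ in $\mathbf A$, $b_1\rightarrow_{as}b_2$ in $\mathbf B$, and $(a_1,b_1),(a_1,b_2),(a_2,b_1)\in R$, then $(a_2,b_2)\in R$. - Relational 3: if $R\le\mathbf A\times\mathbf B\times\mathbf C$, $a_1\rightarrow_{sm}a_2$ in $\mathbf A$, $b_1\rightarrow_{sm}b_2$ in $\mathbf B$, $c_1\rightarrow_{sm}c_2$ in $\mathbf C$, and $(a_1,b_2,c_2),(a_2,b_1,c_2),(a_2,b_2,c_1)\in R$, then $(a_2,b_2,c_2)\in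 R$. *)

(* Defs.v *)
From HB Require Import structures.
From mathcomp Require Import all_boot all_algebra.
From mathcomp Require Import boolp.

Set Implicit Arguments.
Unset Strict Implicit.
Unset Printing Implicit Defensive.

Import GRing.Theory.

Record signature := Signature { sym : Type; arity : sym -> nat }.

Definition interpretation (S : signature) (T : Type) : Type :=
  forall f : sym S, {ffun 'I_(arity f) -> T} -> T.

Inductive term (S : signature) (X : Type) : Type :=
  | Var of X
  | App (f : sym S) of 'I_(arity f) -> term S X.

Fixpoint eval (S : signature) (T X : Type) (I : interpretation S T)
    (t : term S X) (v : X -> T) : T :=
  match t with
  | Var x => v x
  | App f ts => I f [ffun i => eval I (ts i) v]
  end.

(* A term t(x_1, ..., x_n) is an element of [nterm S n]; its variables are
   numbered from 0. *)
Notation nterm S n := (term S 'I_n).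

Definition holds (S : signature) (T X : Type) (I : interpretation S T)
    (e : term S X * term S X) : Prop :=
  forall v : X -> T, eval I e.1 v = eval I e.2 v.

Record algebra (S : signature) := MkAlgebra {
  carrier :> finType;
  op : interpretation S carrier;
  op_idem : forall (f : sym S) (x : carrier), @op f [ffun=> x] = x;
  carrier_gt0 : 0 < #|carrier| }.

Arguments op {S A} f x : rename.

Definition teval (S : signature) (X : Type) (A : algebra S)
  (t : term S X) (v : X -> A) : A := eval (@op S A) t v.

Section Constructions.
Variable S : signature.
Implicit Types A B C : algebra S.

Definition is_hom A B (h : A -> B) : Prop :=
  forall (f : sym S) (x : {ffun 'I_(arity f) -> A}),
    h (op f x) = op f [ffun i => h (x i)].

Definition subuniverse A (U : {set A}) : Prop :=
  forall (f : sym S) (x : {ffun 'I_(arity f) -> A}),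
    (forall i, x i \in U) -> op f x \in U.

Definition Sg A (X : {set A}) : {set A} :=
  \bigcap_(U : {set A} | `[< subuniverse U >] && (X \subset U)) U.

Record subalgebra A := Subalgebra {
  universe : {set A};
  universe_closed : subuniverse universe;
  universe_neq0 : universe != set0 }.

Section SubAlg.
Variables (A : algebra S) (U : subalgebra A).

Definition sub_carrier : finType := {x : A | x \in universe U}.

Lemma sub_op_subproof (f : sym S) (x : {ffun 'I_(arity f) -> sub_carrier}) :
  op f [ffun i => val (x i)] \in universe U.
Proof. by apply: universe_closed => i; rewrite ffunE; exact: valP. Qed.

Definition sub_op : interpretation S sub_carrier :=
  fun f x => Sub (op f [ffun i => val (x i)]) (sub_op_subproof x).

Lemma sub_op_idem (f : sym S) (x : sub_carrier) : @sub_op f [ffun=> x] = x.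
Proof.
apply: val_inj; rewrite SubK -[RHS](op_idem f).
by congr op; apply/ffunP => i; rewrite !ffunE.
Qed.

Lemma sub_carrier_gt0 : 0 < #|sub_carrier|.
Proof.
have /set0Pn [x xU] := universe_neq0 U.
by apply/card_gt0P; exists (Sub x xU).
Qed.

Definition alg_of_sub : algebra S := MkAlgebra sub_op_idem sub_carrier_gt0.
End SubAlg.

Section ProdAlg.
Variables A B : algebra S.

Definition prod_op : interpretation S (A * B)%type :=
  fun f x => (op f [ffun i => (x i).1], op f [ffun i => (x i).2]).

Lemma prod_op_idem (f : sym S) (x : A * B) : @prod_op f [ffun=> x] = x.
Proof.
case: x => a b; rewrite /prod_op; congr pair.
  by rewrite -[RHS](op_idem f); congr op; apply/ffunP => i; rewrite !ffunE.
by rewrite -[RHS](op_idem f); congr op; apply/ffunP => i; rewrite !ffunE.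
Qed.

Lemma prod_carrier_gt0 : 0 < #|{: A * B}|.
Proof. by rewrite card_prod muln_gt0 !carrier_gt0. Qed.

Definition prod_alg : algebra S := MkAlgebra prod_op_idem prod_carrier_gt0.
End ProdAlg.

Section PowAlg.
Variables (A : algebra S) (n : nat).

Definition pow_op : interpretation S {ffun 'I_n -> A} :=
  fun f x => [ffun j => op f [ffun i => x i j]].

Lemma pow_op_idem (f : sym S) (x : {ffun 'I_n -> A}) :
  @pow_op f [ffun=> x] = x.
Proof.
apply/ffunP => j; rewrite ffunE -[RHS](op_idem f).
by congr op; apply/ffunP => i; rewrite !ffunE.
Qed.

Lemma pow_carrier_gt0 : 0 < #|{ffun 'I_n -> A}|.
Proof. by rewrite card_ffun expn_gt0 carrier_gt0. Qed.

Definition pow_alg : algebra S := MkAlgebra pow_op_idem pow_carrier_gt0.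
End PowAlg.

Definition HSPfin A B : Prop :=
  exists (n : nat) (U : subalgebra (pow_alg A n)) (h : alg_of_sub U -> B),
    is_hom h /\ (forall b, exists u, h u = b).

End Constructions.

Definition sig1 (n : nat) : signature :=
  {| sym := unit; arity := fun=> n |}.

Definition interp1 (n : nat) (T : Type) (g : {ffun 'I_n -> T} -> T) :
  interpretation (sig1 n) T := fun=> g.

Inductive lmod_sym (R : Type) : Type :=
  | LZero | LOpp | LAdd | LScale of R.

Definition lmod_sig (R : Type) : signature :=
  {| sym := lmod_sym R;
     arity := fun s => match s with
                       | LZero => 0 | LOpp => 1 | LAdd => 2 | LScale _ => 1
                       end |}.

Definition lmod_interp (R : pzRingType) (M : lmodType R) :
    interpretation (lmod_sig R) M :=
  fun s => match s return {ffun 'I_(@arity (lmod_sig R) s) -> M} -> M with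
           | LZero => fun=> 0%R
           | LOpp => fun x => (- x ord0)%R
           | LAdd => fun x => (x ord0 + x ord_max)%R
           | LScale r => fun x => (r *: x ord0)%R
           end.

Arguments lmod_interp {R} M f x.

(* Polynomial operations: term operations with elements of T substituted for
   some of the variables. *)
Definition polynomial_op (S : signature) (T : Type) (I : interpretation S T)
    (n : nat) (p : {ffun 'I_n -> T} -> T) : Prop :=
  exists t : term S ('I_n + T),
    forall x, p x = eval I t (fun v => match v with
                                       | inl i => x i
                                       | inr a => a
                                       end).

Section Notions.
Variable S : signature.
Implicit Types A B C : algebra S.

Definition taylor_term A (n : nat) (t : nterm S n) : Prop :=
  (forall x : A, teval t (fun=> x) = x) /\
  exists (k : nat) (E : 'I_k -> term (sig1 n) nat * term (sig1 n) nat),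
    (forall j, holds (interp1 (fun x : {ffun 'I_n -> A} => teval t x)) (E j)) /\
    (forall (T : Type) (i : 'I_n), (exists x y : T, x <> y) ->
       ~ (forall j, holds (interp1 (fun x : {ffun 'I_n -> T} => x i)) (E j))).

(* Clones consist of operations of positive arity. *)
Definition generates_clone A (n : nat) (t : nterm S n) : Prop :=
  forall (m : nat) (s : nterm S m), 0 < m ->
    exists s' : nterm (sig1 n) m, forall x : 'I_m -> A,
      eval (interp1 (fun y : {ffun 'I_n -> A} => teval t y)) s' x = teval s x.

Definition minimal_taylor A : Prop :=
  (exists (n : nat) (t : nterm S n), taylor_term A t) /\
  (forall (n : nat) (t : nterm S n), taylor_term A t -> generates_clone A t).

(* An element of [GRing.Lmodule.axioms_ R A] is a left R-module structure on
   the type A itself. *)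
Definition affine A : Prop :=
  exists (R : pzRingType) (m : GRing.Lmodule.axioms_ R A),
    forall (n : nat) (p : {ffun 'I_n -> A} -> A),
      polynomial_op (@op S A) p <->
      polynomial_op (lmod_interp (GRing.Lmodule.Pack m)) p.

Definition has_majority_term A : Prop :=
  exists m : nterm S 3, forall x y : A,
    [/\ teval m (tnth [tuple x; x; y]) = x,
        teval m (tnth [tuple x; y; x]) = x &
        teval m (tnth [tuple y; x; x]) = x].

Definition acts_as_semilattice A (t : nterm S 2) (a b : A) : Prop :=
  [/\ teval t (tnth [tuple a; a]) = a, teval t (tnth [tuple b; b]) = b,
      teval t (tnth [tuple a; b]) = b & teval t (tnth [tuple b; a]) = b].

Definition cyclic_term (V : algebra S -> Prop) (n : nat) (c : nterm S n) :
    Prop :=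
  0 < n /\
  forall A, V A ->
    (forall x : A, teval c (fun=> x) = x) /\
    (forall x : 'I_n -> A, teval c x = teval c (fun i => x (ordS i))).

Definition digraphs : Type := forall A : algebra S, A -> A -> Prop.

Definition strong (as_ sm : digraphs) : digraphs :=
  fun A a b => as_ A a b /\ sm A a b.

Section EdgeAxioms.
Variables (V : algebra S -> Prop) (as_ sm : digraphs).

Definition base1 : Prop :=
  forall A, V A -> forall B : subalgebra A, affine (alg_of_sub B) ->
  forall a b, a \in universe B -> b \in universe B -> as_ a b.

Definition base2 : Prop :=
  forall A, V A -> forall B : subalgebra A, has_majority_term (alg_of_sub B) ->
  forall a b, a \in universe B -> b \in universe B -> sm a b.

Definition base3 : Prop :=
  forall A, V A -> forall a b : A,
  (exists t : nterm S 2, acts_as_semilattice t a b) -> strong as_ sm a b.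

Definition homomorphism1 (e : digraphs) : Prop :=
  forall A B, V A -> V B -> forall f : A -> B, is_hom f ->
  forall a b : A, e A a b -> e B (f a) (f b).

Definition homomorphism2 (e : digraphs) : Prop :=
  forall A B, V A -> V B -> forall f : A -> B, is_hom f ->
  forall a b : A, e B (f a) (f b) ->
  forall b' : A, f b' = f b ->
    (forall c : A, f c = f b -> Sg [set a; c] \subset Sg [set a; b'] ->
       Sg [set a; c] = Sg [set a; b']) ->
    e A a b'.

Definition relational1 : Prop :=
  forall A B, V A -> V B -> forall R : subalgebra (prod_alg A B),
  forall (a1 a2 : A) (b1 b2 : B), as_ a1 a2 -> sm b1 b2 ->
    (a1, b2) \in universe R -> (a2, b1) \in universe R ->
    (a2, b2) \in universe R.

Definition relational2 : Prop :=
  forall A B, V A -> V B -> forall R : subalgebra (prod_alg A B),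
  forall (a1 a2 : A) (b1 b2 : B), as_ a1 a2 -> as_ b1 b2 ->
    (a1, b1) \in universe R -> (a1, b2) \in universe R ->
    (a2, b1) \in universe R ->
    (a2, b2) \in universe R.

Definition relational3 : Prop :=
  forall A B C, V A -> V B -> V C ->
  forall R : subalgebra (prod_alg (prod_alg A B) C),
  forall (a1 a2 : A) (b1 b2 : B) (c1 c2 : C),
    sm a1 a2 -> sm b1 b2 -> sm c1 c2 ->
    (a1, b2, c2) \in universe R -> (a2, b1, c2) \in universe R ->
    (a2, b2, c1) \in universe R ->
    (a2, b2, c2) \in universe R.

Record edge_axioms : Prop := EdgeAxioms {
  edge_base1 : base1;
  edge_base2 : base2;
  edge_base3 : base3;
  edge_hom1_as : homomorphism1 as_;
  edge_hom1_sm : homomorphism1 sm;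
  edge_hom2_as : homomorphism2 as_;
  edge_hom2_sm : homomorphism2 sm;
  edge_hom2_s : homomorphism2 (strong as_ sm);
  edge_rel1 : relational1;
  edge_rel2 : relational2;
  edge_rel3 : relational3 }.

End EdgeAxioms.

Definition as_Z (V : algebra S -> Prop) : digraphs :=
  fun A a b =>
    forall (n : nat) (c : nterm S n), cyclic_term V c ->
      b \in Sg [set a; teval c (fun i => if i.+1 == n then b else a)].

Definition sm_Z (V : algebra S -> Prop) : digraphs :=
  fun A a b =>
    forall (t : nterm S 2) (n : nat) (c : nterm S n) (k : nat),
      cyclic_term V c -> 0 < k -> k.*2 <= n ->
      b \in Sg [set a; teval t
        (tnth [tuple b; teval c (fun i => if i < k then a else b)])].

End Notions.

(* Main.v *)
From mathcomp Require Import all_boot all_algebra all_fingroup all_solvable.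
From mathcomp Require Import boolp zify.
Require Import Defs.

(** The relational axioms become short computations once the variety has a cyclic
    term of some odd arity at least 3, and the base axioms follow from
    minimality: for a semilattice or majority edge one composes such a term with
    joins or majorities, obtaining a cyclic, hence Taylor, hence clone-generating
    term that acts on [{a, b}] as the join or the majority; in the affine case
    [x |-> c(a, ..., a, x)] is a permutation.

    Cyclic terms of prime arity [p > #|A|] exist because every nonempty
    shift-invariant [R <= A ^ p] contains a constant tuple, by induction on
    [#|A|].  If [A] has a proper binary absorbing subuniverse or is not simple,
    [R] meets a power of a smaller algebra.  Otherwise consider the subuniverses
    [C] with no essential relation of arity at least 3 (ternary absorption).  If a
    proper one exists, the binary projections of [R] move such sets around, and a
    set in a terminal class of this motion meets itself under every projection,
    so [R] meets [C ^ p].  If none exists, then for every set [J] of coordinates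
    on which [R] projects onto [A ^ J] each other coordinate is free or a function
    of those in [J]; hence [#|R|] is a power of [#|A|], prime to [p], and the shift
    has a fixed point in [R].  Ternary absorbing sets arise as centers
    [{a | forall d, W a d}] of relations [W <= A * D] with [D] binary absorption
    free. *)

Set Implicit Arguments.
Unset Strict Implicit.
Unset Printing Implicit Defensive.

Local Open Scope nat_scope.

Fixpoint subst (S : signature) (X Y : Type) (t : term S X)
    (s : X -> term S Y) : term S Y :=
  match t with
  | Var x => s x
  | App f ts => App (f := f) (fun i => subst (ts i) s)
  end.

Fixpoint expand (S : signature) (n : nat) (t : nterm S n) (X : Type)
    (s : term (sig1 n) X) : term S X :=
  match s with
  | Var x => Var S x
  | App _ ts => subst t (fun i => expand t (ts i))
  end.

(** * Terms and identities *)

Section Terms.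
Variable S : signature.
Implicit Types A B D : algebra S.

Lemma teval_ext X A (t : term S X) (v w : X -> A) :
  v =1 w -> teval t v = teval t w.
Proof. by move=> /funext ->. Qed.

Lemma teval_App X A (f : sym S) (ts : 'I_(arity f) -> term S X) (v : X -> A) :
  teval (App ts) v = op f [ffun i => teval (ts i) v].
Proof. by []. Qed.

Lemma teval_subst X Y A (t : term S X) (s : X -> term S Y) (v : Y -> A) :
  teval (subst t s) v = teval t (fun x => teval (s x) v).
Proof.
elim: t => //= f ts IH; rewrite !teval_App.
by congr op; apply/ffunP => i; rewrite !ffunE IH.
Qed.

Lemma teval_idem X A (t : term S X) (a : A) : teval t (fun=> a) = a.
Proof.
elim: t => //= f ts IH; rewrite teval_App -[RHS](op_idem f).
by congr op; apply/ffunP => i; rewrite !ffunE IH.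
Qed.

Lemma teval_diag X A (t : term S X) (a : A) (v : X -> A) :
  (forall x, v x = a) -> teval t v = a.
Proof. by move=> va; rewrite -[RHS](teval_idem t); exact: teval_ext. Qed.

Lemma teval_expand n (t : nterm S n) X A (s : term (sig1 n) X) (v : X -> A) :
  teval (expand t s) v =
  eval (interp1 (fun y : {ffun 'I_n -> A} => teval t y)) s v.
Proof.
elim: s => //= f ts IH; rewrite teval_subst.
by apply: teval_ext => i; rewrite ffunE IH.
Qed.

Lemma hom_teval A B (h : A -> B) X (t : term S X) (v : X -> A) :
  is_hom h -> h (teval t v) = teval t (h \o v).
Proof.
move=> hh; elim: t => //= f ts IH; rewrite !teval_App hh.
by congr op; apply/ffunP => i; rewrite !ffunE IH.
Qed.

Lemma subuniverse_teval A (U : {set A}) X (t : term S X) (v : X -> A) :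
  subuniverse U -> (forall x, v x \in U) -> teval t v \in U.
Proof.
move=> hU hv; elim: t => //= f ts IH; rewrite teval_App.
by apply: hU => i; rewrite ffunE.
Qed.

Definition compatible2 A B (W : A -> B -> Prop) : Prop :=
  forall (f : sym S) (x : {ffun 'I_(arity f) -> A})
    (y : {ffun 'I_(arity f) -> B}),
    (forall i, W (x i) (y i)) -> W (op f x) (op f y).

(** Relations are predicates rather than subalgebras of a power, so that the index type is arbitrary
    and nonemptiness is not built in. *)
Definition compatible A (X : Type) (P : (X -> A) -> Prop) : Prop :=
  forall (f : sym S) (x : 'I_(arity f) -> X -> A),
    (forall i, P (x i)) -> P (fun j => op f [ffun i => x i j]).

Lemma compatible2_teval A B (W : A -> B -> Prop) X (t : term S X)
    (v : X -> A) (w : X -> B) :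
  compatible2 W -> (forall x, W (v x) (w x)) -> W (teval t v) (teval t w).
Proof.
move=> hW hv; elim: t => //= f ts IH; rewrite !teval_App.
by apply: hW => i; rewrite !ffunE.
Qed.

Lemma compatible_teval A X (P : (X -> A) -> Prop) Y (t : term S Y)
    (v : Y -> X -> A) :
  compatible P -> (forall y, P (v y)) ->
  P (fun j => teval t (fun y => v y j)).
Proof.
move=> hP hv; elim: t => [y|f ts IH]; first exact: hv.
suff -> : (fun j => teval (App ts) (fun y => v y j)) =
  (fun j => op f [ffun i => (fun j => teval (ts i) (fun y => v y j)) j]).
  exact: hP.
by apply: funext => j; rewrite teval_App; congr op; apply/ffunP => i; rewrite !ffunE.
Qed.

Definition identity A X (l r : term S X) : Prop :=
  forall v : X -> A, teval l v = teval r v.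

Lemma sub_val_hom A (U : subalgebra A) : @is_hom S (alg_of_sub U) A val.
Proof. by []. Qed.

Lemma identity_sub A (U : subalgebra A) X (l r : term S X) :
  identity A l r -> identity (alg_of_sub U) l r.
Proof.
move=> h v; apply: val_inj.
by rewrite !(@hom_teval (alg_of_sub U) A val) //; exact: sub_val_hom.
Qed.

Lemma identity_surj A B (h : A -> B) X (l r : term S X) :
  is_hom h -> (forall b, exists a, h a = b) ->
  identity A l r -> identity B l r.
Proof.
move=> hh sh id v; have [g hg] := choice (fun x => sh (v x)).
have -> : v = h \o g by apply: funext => x /=.
by rewrite -!hom_teval // id.
Qed.

Lemma identity_pow A n X (l r : term S X) :
  identity A l r -> identity (pow_alg A n) l r.
Proof.
move=> h v; apply/ffunP => j.
have hj : @is_hom S (pow_alg A n) A (fun x => x j).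
  by move=> f x; rewrite ffunE.
by rewrite (hom_teval l v hj) (hom_teval r v hj) h.
Qed.

Lemma identity_HSPfin A B X (l r : term S X) :
  HSPfin A B -> identity A l r -> identity B l r.
Proof.
case=> n [U [h [hh sh]]] id.
exact: (identity_surj hh sh (identity_sub (@identity_pow _ n _ _ _ id))).
Qed.

Lemma identity_expand A n (t : nterm S n) X (l r : term (sig1 n) X) :
  holds (interp1 (fun y : {ffun 'I_n -> A} => teval t y)) (l, r) <->
  identity A (expand t l) (expand t r).
Proof. by split=> h v; have := h v; rewrite !teval_expand. Qed.

End Terms.

(** * Binary absorption and transitive terms *)

Section Transitive.
Variable S : signature.
Implicit Types A B D : algebra S.

Definition taylor A : Prop := exists n (t : nterm S n), taylor_term A t.

Lemma taylor_transfer A B :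
  (forall l r : term S nat, identity A l r -> identity B l r) ->
  taylor A -> taylor B.
Proof.
move=> AB [n [t [_ [k [E [hE nE]]]]]].
exists n, t; split; first by move=> x; exact: teval_idem.
exists k, E; split=> // j; have := hE j; case: (E j) => l r.
by move=> /identity_expand /AB /identity_expand.
Qed.

(** The star product of terms. Arguments that depend on one of the two indices only turn it back
    into [t] or into [s], by idempotence. *)
Definition star X Y (t : term S X) (s : term S Y) : term S (X * Y) :=
  subst t (fun x => subst s (fun y => Var S (x, y))).

Lemma teval_star A X Y (t : term S X) (s : term S Y) (v : X * Y -> A) :
  teval (star t s) v = teval t (fun x => teval s (fun y => v (x, y))).
Proof.
by rewrite teval_subst; apply: teval_ext => x; rewrite teval_subst.
Qed.

Definition preserves_at A X (t : term S X) (x : X) (U : {set A}) : Prop :=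
  forall v : X -> A, v x \in U -> teval t v \in U.

Definition binary_absorbing A (U : {set A}) : Prop :=
  exists b : term S bool, forall x, preserves_at b x U.

Definition binary_absorption_free A : Prop :=
  forall U : {set A}, subuniverse U -> U != set0 -> binary_absorbing U ->
  U = setT.

Lemma preserves_at_star A X Y (t : term S X) (s : term S Y) x y (U : {set A}) :
  preserves_at (star t s) (x, y) U -> preserves_at t x U /\ preserves_at s y U.
Proof.
move=> h; split=> v vU.
  have := h (v \o fst) vU; rewrite teval_star.
  by rewrite (@teval_ext _ _ _ t _ v) // => z; exact: (teval_idem s (v z)).
have := h (v \o snd) vU; rewrite teval_star /= => hh.
by rewrite teval_idem in hh.
Qed.

Lemma preserves_at_binary A (X : eqType) (t : term S X) x y (U : {set A}) :
  x != y -> preserves_at t x U -> preserves_at t y U -> binary_absorbing U.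
Proof.
move=> xy tx ty; exists (subst t (fun z => Var S (z == x))) => -[] v vU.
  by rewrite teval_subst; apply: tx; rewrite /= eqxx.
by rewrite teval_subst; apply: ty; rewrite /= eq_sym (negbTE xy).
Qed.

Lemma eval_projection n (i : 'I_n) T (s : term (sig1 n) nat) (v : nat -> T) :
  eval (interp1 (fun x : {ffun 'I_n -> T} => x i)) s v =
  v (eval (interp1 (fun x : {ffun 'I_n -> nat} => x i)) s id).
Proof. by elim: s => //= f ts IH; rewrite /interp1 !ffunE. Qed.

(* A set U preserved by every term at some coordinate, but not absorbing, is
   preserved at exactly one coordinate of each term; mapping each term to
   that coordinate is a clone homomorphism to the projections. *)
Lemma taylor_avoids A (U : {set A}) :
  taylor A -> binary_absorption_free A -> U != set0 -> U != setT ->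
  exists (X : finType) (t : term S X), forall x, ~ preserves_at t x U.
Proof.
move=> [n [t [_ [k [E [hE nE]]]]]] free U0 UT; apply: contrapT => none.
have pres (X : finType) (s : term S X) : exists x, preserves_at s x U.
  by apply: contrapT => h; apply: none; exists X, s => x hx; apply: h; exists x.
have subU : subuniverse U.
  move=> f x xU; have [i hi] := pres _ (App (fun i : 'I_(arity f) => Var S i)).
  have := hi x (xU i); rewrite teval_App.
  suff -> : [ffun j => teval (Var S j) x] = x by [].
  by apply/ffunP => j; rewrite ffunE.
have nabs : ~ binary_absorbing U by move=> /(free _ subU U0) /eqP; exact/negP.
have [i0 hi0] := pres _ t.
pose var (s : term (sig1 n) nat) :=
  eval (interp1 (fun x : {ffun 'I_n -> nat} => x i0)) s id.
have hvar s : preserves_at (expand t s) (var s) U.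
  rewrite /var; elim: s => [x v //|f ts IH v]; rewrite /= /interp1 ffunE => vU.
  by rewrite teval_subst; apply: hi0; apply: IH.
have two : exists x y : nat, x <> y by exists 0, 1.
refine (nE nat i0 two _) => j v; rewrite eval_projection [RHS]eval_projection; congr (v _).
apply/eqP/negPn/negP => neq; apply: nabs.
apply: (preserves_at_binary neq (hvar _)).
(* The identity [E j] makes its left side preserved also at the variable that belongs to its right
   side; two distinct such variables make [U] binary absorbing. *)
move=> w wU; have := hvar (E j).2 w wU.
have := hE j; case: (E j) => l r /identity_expand -> //.
Qed.

Definition transitive_term A (X : Type) (t : term S X) : Prop :=
  forall x b c, exists v : X -> A, v x = b /\ teval t v = c.

(** A star product of terms avoiding each proper nonempty [U] in turn preserves none of these sets
    at any coordinate. Its iterated star products, with one argument fixed, take more and more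
    values until they take all. *)
Lemma taylor_transitive A :
  taylor A -> binary_absorption_free A ->
  exists (X : finType) (t : term S X), transitive_term A t.
Proof.
move=> tA free.
have [X [t ht]] : exists (X : finType) (t : term S X),
    forall U : {set A}, U != set0 -> U != setT -> forall x, ~ preserves_at t x U.
  suff [X [t ht]] : exists (X : finType) (t : term S X),
      forall U : {set A}, U \in enum {set A} -> U != set0 -> U != setT ->
      forall x, ~ preserves_at t x U.
    by exists X, t => U; apply: ht; rewrite mem_enum.
  elim: (enum _) => [|U l [X [t ht]]]; first by exists unit, (Var S tt).
  have [UP|UP] := pselect (U != set0 /\ U != setT); last first.
    exists X, t => V; rewrite inE => /predU1P[->|/ht //] V0 VT.
    by case: UP.
  have [Y [s hs]] := taylor_avoids tA free UP.1 UP.2.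
  exists (X * Y)%type, (star t s) => V; rewrite inE => VP V0 VT [x y].
  move=> pxy; have [px py] := preserves_at_star pxy; 
  case/predU1P: VP => [VU|Vl]; last exact: (ht V Vl V0 VT x px).
  by apply: (hs y); rewrite -VU.
pose rch (Y : finType) (s : term S Y) y b : {set A} :=
  [set c | `[< exists v, v y = b /\ teval s v = c >]].
suff [Y [s hs]] : exists (Y : finType) (s : term S Y),
    forall y b, rch Y s y b = setT.
  exists Y, s => y b c; have : c \in rch Y s y b by rewrite hs inE.
  by rewrite inE => /asboolP.
suff [Y [s hs]] : exists (Y : finType) (s : term S Y),
    forall y b, rch Y s y b = setT \/ #|A| <= #|rch Y s y b|.
  exists Y, s => y b; case: (hs y b) => // h; apply/eqP.
  by rewrite eqEcard subsetT cardsT.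
elim: #|A| => [|m [Y [s hs]]].
  by exists unit, (Var S tt) => y b; right.
exists (X * Y)%type, (star t s) => -[x y] b.
have sub1 (c : A) (w : X -> A) : w x \in rch Y s y b ->
    teval t w \in rch (X * Y)%type (star t s) (x, y) b.
  rewrite !inE => /asboolP [v [vy vw]]; apply/asboolP.
  exists (fun z => if z.1 == x then v z.2 else w z.1); rewrite /= eqxx; split=> //.
  rewrite teval_star; apply: teval_ext => z /=; case: eqP => [->//|_].
  by rewrite teval_idem.
have sub : rch Y s y b \subset rch (X * Y)%type (star t s) (x, y) b.
  by apply/subsetP => c cs; have := sub1 c (fun=> c) cs; rewrite teval_idem.
case: (hs y b) => [full|lem].
  by left; apply/eqP; rewrite eqEsubset subsetT -full.
have [full|nfull] := eqVneq (rch Y s y b) setT.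
  by left; apply/eqP; rewrite eqEsubset subsetT -full.
(* If the set of reachable values did not grow, [t] would preserve it at [x]. *)
right; apply: (leq_ltn_trans lem); apply: proper_card.
rewrite properE sub /=; apply/negP => sub'.
apply: (ht (rch Y s y b) _ nfull x).
  by apply/set0Pn; exists b; rewrite inE; apply/asboolP; exists (fun=> b); rewrite teval_idem.
by move=> w wx; apply: (subsetP sub'); exact: sub1.
Qed.

End Transitive.

(** * Ternary absorption *)

Section TernaryAbsorption.
Variable S : signature.
Implicit Types A B D : algebra S.

Definition essential A (C : {set A}) (I : Type) (P : (I -> A) -> Prop) : Prop :=
  [/\ compatible P,
      forall i, exists u, P u /\ forall j, j <> i -> u j \in C &
      ~ exists u, P u /\ forall j, u j \in C].

(* Equivalent to absorption by a ternary term, in the form in which it is used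
   and which is inherited by preimages. *)
Definition ternary_absorbing A (C : {set A}) : Prop :=
  forall (I : finType) (P : (I -> A) -> Prop), 2 < #|I| -> ~ essential C P.

Definition absorbs A (C : {set A}) (X : Type) (t : term S X) : Prop :=
  forall x (v : X -> A), (forall y, y <> x -> v y \in C) -> teval t v \in C.

Lemma essential_bij A (C : {set A}) (I J : Type) (h : J -> I)
    (P : (I -> A) -> Prop) :
  bijective h -> essential C P ->
  essential C (fun v : J -> A => exists u, P u /\ v = u \o h).
Proof.
case=> g hg gh [cP ess none]; split.
- move=> f x /choice [u hu].
  exists (fun i => op f [ffun k => u k i]); split.
    by apply: cP => k; case: (hu k).
  apply: funext => j /=; congr op; apply/ffunP => k; rewrite !ffunE.
  by case: (hu k) => _ ->.
- move=> j; have [u [Pu uC]] := ess (h j).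
  exists (u \o h); split; first by exists u.
  by move=> j' ne; apply: uC => /(can_inj hg).
- case=> v [[u [Pu ->]] uC]; apply: none; exists u; split=> // i.
  by have := uC (g i); rewrite /= gh.
Qed.

Lemma eq_card_bijective (I J : finType) :
  #|I| = #|J| -> exists h : I -> J, bijective h.
Proof.
move=> e; exists (enum_val \o cast_ord e \o enum_rank).
apply: bij_comp (enum_rank_bij _); apply: bij_comp (enum_val_bij _) _.
by exists (cast_ord (esym e)); [exact: cast_ordK|exact: cast_ordKV].
Qed.

(** Otherwise assign distinct coordinates to the arguments of [t], as many as there are, and apply
    [t] to the corresponding witnesses: at each coordinate at most one argument lies outside [C], so
    the result is a tuple of [P] inside [C]. *)
Lemma absorbs_essential A (C : {set A}) (X I : finType) (t : term S X)
    (P : (I -> A) -> Prop) :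
  subuniverse C -> absorbs C t -> essential C P -> #|I| < #|X|.
Proof.
move=> subC abs [cP ess none]; rewrite ltnNge; apply/negP => le.
apply: none; have [u hu] := choice ess.
pose g (x : X) : I := enum_val (widen_ord le (enum_rank x)).
have g_inj : injective g.
  move=> x y /enum_val_inj /(congr1 val) /= /ord_inj; exact: enum_rank_inj.
exists (fun i => teval t (fun x => u (g x) i)); split.
  by apply: (@compatible_teval _ _ _ P _ t (fun x => u (g x))) => // x; case: (hu (g x)).
move=> i; have [[x gx]|ng] := pselect (exists x, g x = i).
  apply: (abs x) => y ne; have [_] := hu (g y); apply.
  by rewrite -gx => /g_inj /esym.
apply: subuniverse_teval => // x; have [_] := hu (g x); apply=> e.
by apply: ng; exists x.
Qed.

(* Witness that [(a, a)] is not in the relation generated by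
   [{a} * C] and [C * {a}]. *)
Definition separating A (C : {set A}) (a : A) (T : A -> A -> Prop) : Prop :=
  [/\ compatible2 T, forall c, c \in C -> T a c /\ T c a & ~ T a a].

Definition tails A (C : {set A}) (I : Type) (P : (option I -> A) -> Prop) :
    {set A} :=
  [set z | `[< exists u, [/\ P u, u None = z & forall i, u (Some i) \in C] >]].

Lemma restrict_tail A (C V : {set A}) (I : Type) (P : (option I -> A) -> Prop) :
  essential C P -> subuniverse V -> C \subset V ->
  (exists z, z \in tails C P :&: V) ->
  essential C (fun u => P u /\ u None \in V) /\
  tails C (fun u => P u /\ u None \in V) = tails C P :&: V.
Proof.
move=> [cP ess none] subV CV exz; split; last first.
  apply/setP => z; rewrite !inE; apply/asboolP/andP.
    by case=> u [[Pu uV] <- uC]; split=> //; apply/asboolP; exists u.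
  by case=> /asboolP [u [Pu <- uC]] uV; exists u.
split.
- move=> f x hx; split; first by apply: cP => i; case: (hx i).
  by apply: subV => i; rewrite ffunE; case: (hx i).
- case=> [i|].
    have [u [Pu uC]] := ess (Some i); exists u; split=> //; split=> //.
    by apply: (subsetP CV); apply: uC.
  case: exz => z; rewrite !inE => /andP[/asboolP [u [Pu <- uC]] uV].
  by exists u; split=> // -[j|//].
- by case=> u [[Pu _] uC]; apply: none; exists u.
Qed.

Lemma tails_subuniverse A (C : {set A}) (I : Type)
    (P : (option I -> A) -> Prop) :
  subuniverse C -> compatible P -> subuniverse (tails C P).
Proof.
move=> subC cP f x hx; rewrite inE; apply/asboolP.
have /choice [u hu] i : exists u, [/\ P u, u None = x i & forall k, u (Some k) \in C].
  by have := hx i; rewrite inE => /asboolP.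
exists (fun k => op f [ffun i => u i k]); split.
- by apply: cP => i; case: (hu i).
- by congr op; apply/ffunP => i; rewrite ffunE; case: (hu i).
- by move=> k; apply: subC => i; rewrite ffunE; case: (hu i).
Qed.

(** Induction on the number of tails. Take a tail [a] and a [T] separating it. If [T] relates two
    tails, then the elements [T]-related to [a], or else the [T]-successors of tails, form a
    subuniverse that contains [C], meets the tails and misses [a]; restricting the last coordinate
    to it leaves fewer tails. *)
Lemma separate_tails A (C : {set A}) (I : Type) (P : (option I -> A) -> Prop) :
  subuniverse C -> (forall a, a \notin C -> exists T, separating C a T) ->
  essential C P ->
  exists (P' : (option I -> A) -> Prop) a T,
    [/\ essential C P', separating C a T, a \in tails C P' &
        forall x y, x \in tails C P' -> y \in tails C P' -> ~ T x y].
Proof.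
move=> subC sep; move: {2}_.+1 (ltnSn #|tails C P|) => m.
elim: m P => // m IH P lem ess.
have [cP exP none] := ess.
have [a aE] : exists a, a \in tails C P.
  have [u [Pu uC]] := exP None.
  by exists (u None); rewrite inE; apply/asboolP; exists u; split=> // i; apply: uC.
have aC : a \notin C.
  apply/negP => aC; apply: none; move: aE; rewrite inE => /asboolP.
  by case=> u [Pu e uC]; exists u; split=> // -[//|]; rewrite e.
have [T sT] := sep a aC; have [cT aT naa] := sT.
have shrink (V : {set A}) : subuniverse V -> C \subset V ->
    (exists z, z \in tails C P :&: V) -> a \notin V ->
    exists (P' : (option I -> A) -> Prop) a T,
    [/\ essential C P', separating C a T, a \in tails C P' &
        forall x y, x \in tails C P' -> y \in tails C P' -> ~ T x y].
  move=> subV CV exz aV; have [ess' tE] := restrict_tail ess subV CV exz.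
  apply: (IH _ _ ess'); rewrite tE.
  apply: (@leq_trans #|tails C P|); last by rewrite -ltnS.
  apply: proper_card; rewrite properE subsetIl /=.
  by apply/subsetPn; exists a => //; rewrite inE (negbTE aV) andbF.
have [[e [eE eT]]|nT] := pselect (exists e, e \in tails C P /\ T e a).
  apply: (shrink [set x | `[< T x a >]]).
  - move=> f x hx; rewrite inE; apply/asboolP.
    rewrite -[X in T _ X](op_idem f); apply: cT => i; rewrite ffunE.
    by have := hx i; rewrite inE => /asboolP.
  - by apply/subsetP => c /aT [_ ?]; rewrite inE; apply/asboolP.
  - by exists e; rewrite inE eE inE; apply/asboolP.
  - by rewrite inE; apply/asboolP.
have [none2|some2] := pselect (forall x y, x \in tails C P -> y \in tails C P -> ~ T x y).
  by exists P, a, T.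
apply: (shrink [set y | `[< exists x, x \in tails C P /\ T x y >]]).
- move=> f y hy; rewrite inE; apply/asboolP.
  have /choice [x hx] i : exists x, x \in tails C P /\ T x (y i).
    by have := hy i; rewrite inE => /asboolP.
  exists (op f [ffun i => x i]); split.
    by apply: tails_subuniverse => // i; rewrite ffunE; case: (hx i).
  by apply: cT => i; rewrite ffunE; case: (hx i).
- apply/subsetP => c /aT [Tac _]; rewrite inE; apply/asboolP.
  by exists a.
- move: some2 => /existsNP [x /existsNP [y]].
  move=> /not_implyP [xE] /not_implyP [yE] /contrapT Txy.
  by exists y; rewrite inE yE inE; apply/asboolP; exists x.
- by rewrite inE; apply/asboolP.
Qed.

(* Two copies of an essential relation are glued at their last coordinate
   through a separating relation. *)
Lemma essential_glue A (C : {set A}) (I : Type) (P : (option I -> A) -> Prop)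
    a (T : A -> A -> Prop) :
  essential C P -> separating C a T -> a \in tails C P ->
  (forall x y, x \in tails C P -> y \in tails C P -> ~ T x y) ->
  exists P' : (I + I -> A) -> Prop, essential C P'.
Proof.
move=> [cP ess none] [cT aT _]; rewrite inE => /asboolP [ua [Pua ua_a uaC]] nT.
exists (fun w => exists u1 u2, [/\ P u1, P u2, T (u1 None) (u2 None),
   (forall i, w (inl i) = u1 (Some i)) & (forall i, w (inr i) = u2 (Some i))]).
split.
- move=> f x hx.
  have [u1 /choice [u2 hu]] := choice hx.
  exists (fun k => op f [ffun i => u1 i k]), (fun k => op f [ffun i => u2 i k]).
  split.
  + by apply: cP => i; case: (hu i).
  + by apply: cP => i; case: (hu i).
  + by apply: cT => i; rewrite !ffunE; case: (hu i).
  + by move=> k; congr op; apply/ffunP => i; rewrite !ffunE; case: (hu i).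
  + by move=> k; congr op; apply/ffunP => i; rewrite !ffunE; case: (hu i).
- have sumf (u1 u2 : option I -> A) : exists w : I + I -> A,
      (forall i, w (inl i) = u1 (Some i)) /\ (forall i, w (inr i) = u2 (Some i)).
    by exists (fun k => match k with inl i => u1 (Some i) | inr i => u2 (Some i) end).
  case=> i; have [u [Pu uC]] := ess (Some i).
    have [w [w1 w2]] := sumf u ua; exists w; split.
      by exists u, ua; split=> //; rewrite ua_a; apply: (aT _ _).2; apply: uC.
    move=> [j|j] ne; last by rewrite w2.
    by rewrite w1; apply: uC => -[e]; apply: ne; rewrite e.
  have [w [w1 w2]] := sumf ua u; exists w; split.
    by exists ua, u; split=> //; rewrite ua_a; apply: (aT _ _).1; apply: uC.
  move=> [j|j] ne; first by rewrite w1.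
  by rewrite w2; apply: uC => -[e]; apply: ne; rewrite e.
- case=> w [[u1 [u2 [P1 P2 T12 w1 w2]]] wC].
  apply: nT T12; rewrite inE; apply/asboolP.
    by exists u1; split=> // i; rewrite -w1.
  by exists u2; split=> // i; rewrite -w2.
Qed.

(** Gluing turns an essential relation of arity [n.+1] into one of arity [n + n], which is larger
    once [n >= 2]. Starting from arity at least 3, the arity grows without bound, against the bound
    given by the absorbing term. *)
Lemma absorbs_ternary A (C : {set A}) (X : finType) (t : term S X) :
  subuniverse C -> absorbs C t ->
  (forall a, a \notin C -> exists T, separating C a T) -> ternary_absorbing C.
Proof.
move=> subC abs sep I P gt2 ess.
suff [J [Q [essQ le]]] : exists (J : finType) (Q : (J -> A) -> Prop),
    essential C Q /\ #|X| + 3 <= #|J|.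
  have := absorbs_essential subC abs essQ.
  by rewrite ltnNge (leq_trans (leq_addr _ _) le).
elim: #|X| => [|m [J [Q [essQ le]]]]; first by exists I, P.
have [n Jn] : exists n, #|J| = n.+1 by case: #|J| le => [|n]; [rewrite addnS|exists n].
have [h hb] : exists h : option 'I_n -> J, bijective h.
  by apply: eq_card_bijective; rewrite card_option card_ord Jn.
have ess1 := essential_bij hb essQ.
have [P' [a [T [essP' sT aE nT]]]] := separate_tails subC sep ess1.
have [Q' essQ'] := essential_glue essP' sT aE nT.
exists ('I_n + 'I_n)%type, Q'; split=> //.
rewrite card_sum !card_ord; move: le; rewrite Jn !addnS ltnS => le.
have n2 : 2 <= n by apply: leq_trans le; rewrite addn0.
by apply: (leq_trans (n := n.+2)); [rewrite !ltnS|rewrite -addn2 leq_add2l].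
Qed.

(** An essential relation for the preimage is carried along [X] to one for [C]. Totality of [X]
    supplies a neighbour at the one coordinate that may leave the preimage. *)
Lemma ternary_preimage A B (X : A -> B -> Prop) (C : {set B}) :
  compatible2 X -> (forall a, exists b, X a b) -> ternary_absorbing C ->
  ternary_absorbing [set a | `[< exists b, b \in C /\ X a b >]].
Proof.
move=> cX totX stC I P gt2 [cP ess none].
apply: (stC I (fun w => exists u, P u /\ forall i, X (u i) (w i)) gt2); split.
- move=> f x /choice [u hu].
  exists (fun k => op f [ffun i => u i k]); split.
    by apply: cP => i; case: (hu i).
  by move=> k; apply: cX => i; rewrite !ffunE; case: (hu i).
- move=> i; have [u [Pu uC]] := ess i.
  have /choice [w hw] j : exists b, X (u j) b /\ (j <> i -> b \in C).
    have [->|/uC] := pselect (j = i).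
      by have [b hb] := totX (u i); exists b; split.
    by rewrite inE => /asboolP [b [bC Xb]]; exists b.
  exists w; split; first by exists u; split=> // j; case: (hw j).
  by move=> j; case: (hw j).
- case=> w [[u [Pu Xuw]] wC]; apply: none; exists u; split=> // j.
  by rewrite inE; apply/asboolP; exists (w j).
Qed.

(** * Centers of relations *)

Section Center.
Variables (A D : algebra S) (W : A -> D -> Prop).
Hypotheses (cW : compatible2 W) (totW : forall a, exists d, W a d).
Hypotheses (tD : taylor D) (fD : binary_absorption_free D).

Definition center : {set A} := [set a | `[< forall d, W a d >]].

Lemma centerP a : reflect (forall d, W a d) (a \in center).
Proof. by rewrite inE; exact: asboolP. Qed.

Lemma center_subuniverse : subuniverse center.
Proof.
move=> f x hx; apply/centerP => d; rewrite -(op_idem f d).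
by apply: cW => i; rewrite ffunE; apply/centerP.
Qed.

Lemma center_absorbs X (t : term S X) : transitive_term D t -> absorbs center t.
Proof.
move=> tr x v vC; apply/centerP => d.
have [e We] := totW (v x); have [w [wx <-]] := tr x e d.
apply: compatible2_teval => // y.
by have [->|/vC /centerP] := pselect (y = x); [rewrite wx|exact].
Qed.

(** [T] is the relation generated by the pairs required of a separating relation. If a term produced
    [(a, a)] from them, a binary minor of it would make the neighbourhood of [a] absorb [D]; then
    the neighbourhood is [D] and [a] is central. *)
Lemma center_separating a : a \notin center -> exists T, separating center a T.
Proof.
move=> aC.
pose gen (z : A * A) : Prop :=
  (z.1 = a /\ z.2 \in center) \/ (z.1 \in center /\ z.2 = a).
pose X := {z | gen z}.
exists (fun x y => exists s : term S X,
  x = teval s (fun z => (sval z).1) /\ y = teval s (fun z => (sval z).2)).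
split.
- move=> f x y /choice [s hs]; exists (App s); rewrite !teval_App.
  by split; congr op; apply/ffunP => i; rewrite ffunE; case: (hs i).
- move=> c cC; split.
    have g : gen (a, c) by left.
    by exists (Var S (exist _ _ g)).
  have g : gen (c, a) by right.
  by exists (Var S (exist _ _ g)).
- case=> s [s1 s2].
  pose U : {set D} := [set d | `[< W a d >]].
  have UP d : reflect (W a d) (d \in U) by rewrite inE; exact: asboolP.
  case/negP: (aC); apply/centerP => d; apply/UP.
  suff -> : U = setT by rewrite inE.
  apply: fD.
  + move=> f x hx; apply/UP; rewrite -[X in W X _](op_idem f).
    by apply: cW => i; rewrite ffunE; apply/UP.
  + by have [e We] := totW a; apply/set0Pn; exists e; apply/UP.
  (* Generators with first entry [a] become the variable [true], the others [false]. Reading first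
     or second entries, every place holds either a central element, related to anything, or [a]
     against the argument lying in [U]. *)
  + exists (subst s (fun z => Var S ((sval z).1 == a))) => -[] v /UP av; apply/UP.
      rewrite teval_subst {1}s1; apply: compatible2_teval => // -[z gz] /=.
      case: eqP => [-> //|ne]; case: gz => [[/ne //]|[zC _]].
      by move/centerP: zC; apply.
    rewrite teval_subst {1}s2; apply: compatible2_teval => // -[z gz] /=.
    case: gz => -[z1 z2]; first by move/centerP: z2; apply.
    by case: eqP => [za|_]; [rewrite -za z1 in aC|rewrite z2].
Qed.

Lemma center_ternary : ternary_absorbing center.
Proof.
have [X [t tr]] := taylor_transitive tD fD.
exact: (absorbs_ternary center_subuniverse (center_absorbs tr) center_separating).
Qed.

End Center.
End TernaryAbsorption.

(** * Simple algebras *)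

Section Linked.
Variable S : signature.
Implicit Types A B D E : algebra S.

Definition ternary_free A : Prop :=
  forall C : {set A}, subuniverse C -> C != set0 -> ternary_absorbing C -> C = setT.

Lemma taylor_sub A (U : subalgebra A) : taylor A -> taylor (alg_of_sub U).
Proof. by apply: taylor_transfer => l r; exact: identity_sub. Qed.

(* The relation is restricted on the right to a minimal set [D] of neighbours
   of one fixed element that still meets every neighbourhood; this [D] is
   binary absorption free and the left center of the restriction is proper. *)
Lemma common_neighbour A E (W : A -> E -> Prop) :
  taylor E -> binary_absorption_free A -> ternary_free A -> compatible2 W ->
  (forall a a', exists e, W a e /\ W a' e) ->
  exists e, forall a, W a e.
Proof.
move=> tE fA sA cW nb; apply: contrapT => noe.
have /card_gt0P [a1 _] := carrier_gt0 A.
pose F (D : {set E}) := [/\ subuniverse D, forall d, d \in D -> W a1 d &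
  forall a, exists d, d \in D /\ W a d].
pose Fb : pred {set E} := fun D : {set E} => `[< F D >].
have F0 : Fb [set e | `[< W a1 e >]].
  apply/asboolP; split.
  - move=> f x hx; rewrite inE; apply/asboolP; rewrite -[X in W X _](op_idem f).
    by apply: cW => i; have := hx i; rewrite inE ffunE => /asboolP.
  - by move=> d; rewrite inE => /asboolP.
  - move=> a; have [e [W1 W2]] := nb a1 a; exists e; split=> //.
    by rewrite inE; apply/asboolP.
have [D /asboolP [subD DW Da] minD] := arg_minnP (fun D : {set E} => #|D|) F0.
have D0 : D != set0 by have [d [dD _]] := Da a1; apply/set0Pn; exists d.
pose U := Subalgebra subD D0; pose B := alg_of_sub U.
pose W' (a : A) (d : B) := W a (val d).
have cW' : compatible2 W'.
  by move=> f x y h; apply: cW => i; rewrite ffunE; apply: h.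
have totW' a : exists d, W' a d.
  by have [d [dD Wd]] := Da a; exists (Sub d dD); rewrite /W' SubK.
(* The elements with a neighbour in an absorbing [V] absorb [A], hence are all of [A]. So [V] is
   again an admissible choice for [D], and minimality makes it the whole of [D]. *)
have fB : binary_absorption_free B.
  move=> V subV V0 [b hb].
  have YT : [set a | `[< exists d, d \in V /\ W' a d >]] = setT.
    apply: fA.
    - move=> f x hx; rewrite inE; apply/asboolP.
      have /choice [y hy] i : exists d, d \in V /\ W' (x i) d.
        by have := hx i; rewrite inE => /asboolP.
      exists (op f [ffun i => y i]); split.
        by apply: subV => i; rewrite ffunE; case: (hy i).
      by apply: cW' => i; rewrite ffunE; case: (hy i).
    - case/set0Pn: V0 => d dV; apply/set0Pn; exists a1.
      by rewrite inE; apply/asboolP; exists d; split=> //; apply: DW (valP d).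
    - exists b => x v; rewrite !inE => /asboolP [d [dV Wd]]; apply/asboolP.
      have /choice [w hw] z : exists e, W' (v z) e /\ (z = x -> e = d).
        have [->|ne] := pselect (z = x); first by exists d.
        by have [e We] := totW' (v z); exists e.
      exists (teval b w); split; last first.
        by apply: compatible2_teval => // z; case: (hw z).
      by apply: (hb x); have [_ ->] := hw x.
  have FV : Fb (val @: V).
    apply/asboolP; split.
    - move=> f x hx; have /choice [y hy] i : exists d, d \in V /\ x i = val d.
        by have /imsetP [d dV ->] := hx i; exists d.
      apply/imsetP; exists (op f [ffun i => y i]).
        by apply: subV => i; rewrite ffunE; case: (hy i).
      rewrite (sub_val_hom (U := U)); congr op; apply/ffunP => i.
      by rewrite !ffunE; case: (hy i).
    - by move=> _ /imsetP [d _ ->]; apply: DW (valP d).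
    - move=> a; have : a \in [set: A] by [].
      rewrite -YT inE => /asboolP [d [dV Wd]].
      by exists (val d); split=> //; apply: imset_f.
  apply/eqP; rewrite eqEcard subsetT /= cardsT.
  have := minD _ FV; rewrite card_imset; last exact: val_inj.
  by rewrite card_sig.
have CT := sA _ (center_subuniverse cW') _ (center_ternary cW' totW' (taylor_sub U tE) fB).
have {}CT : center W' = setT.
  apply: CT; apply/set0Pn; exists a1; apply/centerP => d; exact: DW (valP d).
have [d dD] := set0Pn _ D0; apply: noe; exists d => a.
have : a \in center W' by rewrite CT.
by move/centerP/(_ (Sub d dD)).
Qed.

Definition congruence A (Q : A -> A -> Prop) : Prop :=
  [/\ compatible2 Q, forall x, Q x x, forall x y, Q x y -> Q y x &
      forall x y z, Q x y -> Q y z -> Q x z].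

Definition simple_alg A : Prop :=
  forall Q : A -> A -> Prop, congruence Q ->
  (forall x y, Q x y -> x = y) \/ (forall x y, Q x y).

Lemma compatible2_comp A B D (Q : A -> B -> Prop) (R : B -> D -> Prop) :
  compatible2 Q -> compatible2 R ->
  compatible2 (fun x z => exists y, Q x y /\ R y z).
Proof.
move=> cQ cR f x z /choice [y hy]; exists (op f [ffun i => y i]).
by split; [apply: cQ|apply: cR] => i; rewrite ffunE; case: (hy i).
Qed.

Lemma tolerance_square_card A (L : A -> A -> Prop) :
  (forall x, L x x) -> ~ (forall x y, (exists z, L x z /\ L z y) -> L x y) ->
  #|{: A * A}| - #|[set z | `[< exists y, L z.1 y /\ L y z.2 >]]| <
  #|{: A * A}| - #|[set z | `[< L z.1 z.2 >]]|.
Proof.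
move=> refl ntr; set M := [set _ | _]; set L' := [set _ | _].
have prop : #|L'| < #|M|.
  apply: proper_card; rewrite properE; apply/andP; split.
    apply/subsetP => z; rewrite !inE => /asboolP Lz; apply/asboolP.
    by exists z.1.
  move: ntr => /existsNP [x /existsNP [y /not_implyP [Mxy nL]]].
  by apply/subsetPn; exists (x, y); rewrite inE; [exact/asboolP|apply/asboolP].
by apply: ltn_sub2l => //; apply: leq_trans prop _; exact: max_card.
Qed.

(** [L] is squared until it becomes transitive; sets closed under [L] are closed under its
    square. *)
Lemma tolerance_congruence A (L : A -> A -> Prop) :
  compatible2 L -> (forall x, L x x) -> (forall x y, L x y -> L y x) ->
  exists Q, [/\ congruence Q, forall x y, L x y -> Q x y &
    forall U : {set A}, (forall x y, L x y -> x \in U -> y \in U) ->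
      forall x y, Q x y -> x \in U -> y \in U].
Proof.
move: {2}_.+1 (ltnSn (#|{: A * A}| - #|[set z | `[< L z.1 z.2 >]]|)) => m.
elim: m L => // m IH L lem cL refl sym.
pose M x z := exists y, L x y /\ L y z.
have LM x y : L x y -> M x y by move=> Lxy; exists y.
have [tr|ntr] := pselect (forall x y, M x y -> L x y).
  by exists L; split=> //; split=> // x y z xy yz; apply: tr; exists y.
have [||||Q [cQ MQ QU]] := IH M.
- by rewrite ltnS in lem; apply: leq_trans lem; exact: tolerance_square_card.
- exact: compatible2_comp.
- by move=> x; apply: LM.
- by move=> x y [z [xz zy]]; exists z; split; apply: sym.
exists Q; split=> //; first by move=> x y /LM /MQ.
move=> U LU; apply: QU => x y [z [xz zy]] xU.
by apply: (LU _ _ zy); exact: (LU _ _ xz).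
Qed.

(** By induction the square of [L] is full unless [L] is already a congruence. Then any two elements
    have a common neighbour, so some element is a neighbour of all; the center of [L] is therefore
    nonempty, and ternary freeness makes it everything. *)
Lemma tolerance_full A (L : A -> A -> Prop) :
  taylor A -> simple_alg A -> binary_absorption_free A -> ternary_free A ->
  compatible2 L -> (forall x, L x x) -> (forall x y, L x y -> L y x) ->
  (exists x y, L x y /\ x <> y) -> forall x y, L x y.
Proof.
move=> tA simA fA sA.
move: {2}_.+1 (ltnSn (#|{: A * A}| - #|[set z | `[< L z.1 z.2 >]]|)) => m.
elim: m L => // m IH L lem cL refl sym ne.
pose M x z := exists y, L x y /\ L y z.
have cM : compatible2 M by exact: compatible2_comp.
have LM x y : L x y -> M x y by move=> Lxy; exists y.
have symM x y : M x y -> M y x by move=> [z [xz zy]]; exists z; split; apply: sym.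
have [tr|ntr] := pselect (forall x y, M x y -> L x y).
  have conL : congruence L by split=> // x y z xy yz; apply: tr; exists y.
  have [eqL|//] := simA L conL.
  by case: ne => x [y [/eqL]].
have fullM : forall x y, M x y.
  apply: IH => //; [|by move=> x; apply: LM|by case: ne => x [y [/LM]]; exists x, y].
  by rewrite ltnS in lem; apply: leq_trans lem; exact: tolerance_square_card.
have [e he] : exists e, forall a, L a e.
  apply: common_neighbour => // a a'.
  by have [e [ae ea']] := fullM a a'; exists e; split=> //; apply: sym.
have tL : forall a, exists d, L a d by move=> a; exists a.
have CT := sA _ (center_subuniverse cL) _ (center_ternary cL tL tA fA).
move=> x y; suff : x \in center L by move/centerP.
rewrite CT ?inE //; apply/set0Pn; exists e; apply/centerP => d; exact: sym.
Qed.

End Linked.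

(** * Cyclic relations *)

Section Quotient.
Variables (S : signature) (A : algebra S) (Q : A -> A -> Prop).
Hypothesis conQ : congruence Q.

(** [pick] depends only on the predicate, so equivalent elements receive the same representative,
    and the quotient can live on the representatives. Reflexivity keeps the default from being
    reached. *)
Definition class_repr (x : A) : A := odflt x [pick y | `[< Q x y >]].

Lemma class_reprP x : Q x (class_repr x).
Proof.
rewrite /class_repr; case: pickP => [y /asboolP //|_].
by case: conQ.
Qed.

Lemma eq_class_repr x y : Q x y -> class_repr x = class_repr y.
Proof.
case: conQ => _ refl sym tr Qxy; rewrite /class_repr.
have e : (fun z => `[< Q x z >]) =1 (fun z => `[< Q y z >]).
  by move=> z; apply/asboolP/asboolP; apply: tr => //; apply: sym.
rewrite (eq_pick e); case: pickP => // /(_ y) /asboolP; case; exact: refl.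
Qed.

Lemma class_repr_idem x : class_repr (class_repr x) == class_repr x.
Proof. by rewrite -(eq_class_repr (class_reprP x)). Qed.

Definition quot_carrier : finType := {x : A | class_repr x == x}.

Definition quot_proj (x : A) : quot_carrier :=
  exist _ (class_repr x) (class_repr_idem x).

Definition quot_op : interpretation S quot_carrier :=
  fun f x => quot_proj (op f [ffun i => val (x i)]).

Lemma quot_op_idem (f : sym S) (x : quot_carrier) : @quot_op f [ffun=> x] = x.
Proof.
apply: val_inj; rewrite -[RHS](eqP (valP x)) SubK; congr class_repr.
by rewrite -[RHS](op_idem f); congr op; apply/ffunP => i; rewrite !ffunE.
Qed.

Lemma quot_carrier_gt0 : 0 < #|quot_carrier|.
Proof.
have /card_gt0P [a _] := carrier_gt0 A.
by apply/card_gt0P; exists (quot_proj a).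
Qed.

Definition quot_alg : algebra S := MkAlgebra quot_op_idem quot_carrier_gt0.

Lemma quot_proj_hom : @is_hom S A quot_alg quot_proj.
Proof.
move=> f x; apply: val_inj; rewrite !SubK; apply: eq_class_repr.
case: conQ => cQ _ _ _; apply: cQ => i; rewrite !ffunE.
exact: class_reprP.
Qed.

Lemma quot_proj_surj (b : quot_alg) : exists a, quot_proj a = b.
Proof. by exists (val b); apply: val_inj; have /eqP := valP b. Qed.

Lemma quot_proj_eq x y : quot_proj x = quot_proj y <-> Q x y.
Proof.
have [_ _ sym tr] := conQ; split=> [/(congr1 val) /= e|Qxy].
  by apply: tr (class_reprP x) _; rewrite e; apply/sym/class_reprP.
by apply: val_inj; exact: eq_class_repr.
Qed.

Lemma card_quot_alg x y : Q x y -> x <> y -> #|quot_alg| < #|A|.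
Proof.
move=> Qxy ne; rewrite /= card_sig -(cardC [pred z | class_repr z == z]).
rewrite -[X in X < _]addn0 ltn_add2l; apply/card_gt0P.
have [ex|nx] := eqVneq (class_repr x) x; last by exists x; rewrite !inE nx.
exists y; rewrite !inE; apply/eqP => ey.
by apply: ne; rewrite -ex -ey; exact: eq_class_repr.
Qed.

End Quotient.

Section CyclicRelations.
Variables (S : signature) (p : nat).
Hypothesis p_prime : prime p.
Implicit Types A B D : algebra S.

(* Subsets of [A ^ p] closed under the cyclic shift are represented by
   [p]-periodic sequences. *)
Definition cyclic_relation A (R : (nat -> A) -> Prop) : Prop :=
  [/\ compatible R, exists r, R r, forall r, R r -> forall i, r (i + p) = r i &
      forall r, R r -> R (fun i => r i.+1)].

Lemma cyclic_shift A (R : (nat -> A) -> Prop) r s :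
  cyclic_relation R -> R r -> R (fun i => r (i + s)).
Proof.
case=> _ _ _ sh Rr; elim: s => [|s IH].
  by rewrite (_ : (fun i => _) = r) //; apply: funext => i; rewrite addn0.
suff -> : (fun i => r (i + s.+1)) = fun i => r (i.+1 + s).
  exact: (sh (fun j => r (j + s))).
by apply: funext => i; rewrite addnS addSn.
Qed.

Lemma cyclic_periodic A (R : (nat -> A) -> Prop) r i j :
  cyclic_relation R -> R r -> i = j %[mod p] -> r i = r j.
Proof.
case=> _ _ per _ Rr; have rm n : r (n %% p) = r n.
  rewrite {2}(divn_eq n p) addnC; elim: (n %/ p) => [|k IH]; first by rewrite addn0.
  by rewrite mulSn addnCA addnC per.
by move=> e; rewrite -rm e rm.
Qed.

(* If [R] is a graph over the coordinates in [J] then [#|R|] is a power of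
   [#|A|], so the prime [p] does not divide it and the shift has a fixed point
   in [R]. *)
Lemma graph_constant A (R : (nat -> A) -> Prop) (J : {set 'I_p}) :
  #|A| < p -> cyclic_relation R ->
  (forall g : 'I_p -> A, exists r, R r /\ forall i, i \in J -> r i = g i) ->
  (forall r r', R r -> R r' -> (forall i, i \in J -> r i = r' i) -> r =1 r') ->
  exists a, R (fun=> a).
Proof.
move=> ltp cR full det.
have p_gt0 := prime_gt0 p_prime.
have [a0 _] := card_gt0P (carrier_gt0 A).
pose X := [set x : {ffun 'I_p -> A} | `[< exists r, R r /\ forall i : 'I_p, x i = r i >]].
have extX (r : nat -> A) : R r -> [ffun i : 'I_p => r i] \in X.
  by move=> Rr; rewrite inE; apply/asboolP; exists r; split=> // i; rewrite ffunE.
have cardX : coprime p #|X|.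
  pose K := {i : 'I_p | i \in J}.
  (* [phi] extends an assignment on [J] to the unique tuple of [X] over it, so [#|X|] is a power of
     [#|A|]. *)
  have /choice [phi hphi] (g : {ffun K -> A}) :
      exists x, x \in X /\ forall i : K, x (val i) = g i.
    have [r [Rr rg]] := full (fun i => oapp g a0 (insub i)).
    exists [ffun i : 'I_p => r i]; split; first exact: extX.
    by move=> i; rewrite ffunE rg ?(valP i) // valK.
  have -> : X = phi @: setT.
    apply/setP => x; apply/idP/imsetP => [xX|[g _ ->]]; last by case: (hphi g).
    exists [ffun i : K => x (val i)] => //.
    have [] := hphi [ffun i : K => x (val i)]; set y := phi _.
    move: xX; rewrite !inE => /asboolP [r [Rr xr]] /asboolP [r' [Rr' yr']] xy.
    apply/ffunP => i; rewrite xr yr'; apply: det => // k kJ.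
    by have := xy (Sub k kJ); rewrite ffunE SubK xr yr' => ->.
  rewrite card_imset; last first.
    move=> g g' e; apply/ffunP => i.
    by case: (hphi g) => _ <-; case: (hphi g') => _ <-; rewrite e.
  rewrite cardsT card_ffun; apply: coprimeXr; rewrite prime_coprime //.
  by apply/negP => /dvdn_leq; rewrite carrier_gt0 leqNgt ltp => /(_ isT).
pose sh (x : {ffun 'I_p -> A}) : {ffun 'I_p -> A} := [ffun i => x (ordS i)].
have sh_inj : injective sh.
  move=> x y /ffunP e; apply/ffunP => i.
  by have := e (ord_pred i); rewrite !ffunE ord_predK.
pose sg := perm sh_inj.
have shX x : x \in X -> sh x \in X.
  rewrite !inE => /asboolP [r [Rr xr]]; apply/asboolP.
  have [_ _ _ shR] := cR; exists (fun i => r i.+1); split; first exact: shR.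
  move=> i; rewrite ffunE xr; apply: (cyclic_periodic cR Rr).
  by rewrite /= modn_mod.
have sgE x i : sg x i = x (ordS i) by rewrite permE ffunE.
have sgp : (sg ^+ p = 1)%g.
  apply/permP => x; rewrite permX perm1.
  have itE k (i j : 'I_p) : j = (i + k) %% p :> nat -> iter k sg x i = x j.
    elim: k i => [|k IH] i e /=.
      by congr (x _); apply: ord_inj; rewrite e addn0 modn_small.
    by rewrite sgE (IH (ordS i)) // e /= modnDml addSnnS.
  by apply/ffunP => i; apply: itE; rewrite modnDr modn_small.
have pg : (p.-group <[sg]>)%g.
  by rewrite /pgroup -orderE; apply: (pnat_dvd _ (pnat_id p_prime)); rewrite order_dvdn sgp.
have acts : [acts <[sg]>%g, on X | 'P].
  by rewrite cycle_subG !inE; apply/subsetP => x xX; rewrite inE /= apermE permE shX.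
(* The shift generates a [p]-group acting on [X], so the number of its fixed points is congruent to
   [#|X|] modulo [p], hence nonzero. *)
have cong := pgroup_fix_mod pg acts.
have [x] : exists x, x \in 'Fix_(X | 'P)(<[sg]>)%g.
  apply/set0Pn; apply/eqP => e; move: cong; rewrite e cards0 mod0n => /eqP.
  by apply/negP; rewrite -/(dvdn _ _) -prime_coprime.
rewrite afix_cycle inE => /andP[]; rewrite inE => /asboolP [r [Rr xr]] /afix1P.
rewrite /= apermE => xfix.
have rS i : r i.+1 = r i.
  have lt : i %% p < p by rewrite ltn_mod.
  rewrite -(@cyclic_periodic _ R r (i %% p) i) ?modn_mod //.
  rewrite -[i %% p]/(nat_of_ord (Ordinal lt)) -xr -xfix sgE xr.
  by apply: (cyclic_periodic cR Rr); rewrite /= modn_mod -[in RHS]addn1 modnDml addn1.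
exists (r 0); rewrite (_ : (fun=> _) = r) //; apply: funext => i.
by elim: i => // i ->.
Qed.
End CyclicRelations.

(** * Constant tuples by induction on the algebra *)

Section CyclicConstant.
Variables (S : signature) (p : nat) (A : algebra S) (R : (nat -> A) -> Prop).
Hypotheses (p_prime : prime p) (cR : cyclic_relation p R).

Hypothesis constant_of_smaller : forall B : algebra S, taylor B ->
  #|B| < #|A| -> forall R' : (nat -> B) -> Prop, cyclic_relation p R' ->
  exists b, R' (fun=> b).

Hypothesis tA : taylor A.
Hypothesis ltp : #|A| < p.

Lemma constant_in_subuniverse (U : {set A}) r :
  subuniverse U -> U != setT -> R r -> (forall i, r i \in U) ->
  exists a, R (fun=> a).
Proof.
move=> subU UT Rr rU; have [cpR _ per sh] := cR.
have U0 : U != set0 by apply/set0Pn; exists (r 0).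
pose B := alg_of_sub (Subalgebra subU U0).
have ltB : #|B| < #|A|.
  by rewrite /= card_sig -[X in _ < X]cardsT; apply: proper_card; rewrite properEneq UT subsetT.
have cR' : cyclic_relation p (fun s : nat -> B => R (fun i => val (s i))).
  split.
  - move=> f x hx; have := cpR f _ hx; congr R; apply: funext => i.
    by rewrite SubK; congr op; apply/ffunP => k; rewrite !ffunE.
  - exists (fun i => exist _ (r i) (rU i)); exact: Rr.
  - by move=> s Rs i; apply: val_inj; exact: per Rs i.
  - by move=> s Rs; exact: sh Rs.
have [b Rb] := constant_of_smaller (taylor_sub _ tA) ltB cR'.
by exists (val b).
Qed.

(** By shift invariance all coordinates have the same projection; if it is proper, [R] lives on a
    smaller algebra. *)
Lemma constant_or_subdirect :
  (exists a, R (fun=> a)) \/ forall i a, exists r, R r /\ r i = a.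
Proof.
have [cpR [r0 Rr0] per sh] := cR.
pose U : {set A} := [set a | `[< exists r, R r /\ r 0 = a >]].
have [UT|UT] := eqVneq U setT.
  right => i a; have : a \in U by rewrite UT.
  rewrite inE => /asboolP [r [Rr <-]].
  exists (fun k => r (k + (p - i %% p))); split; first exact: cyclic_shift cR Rr.
  apply: (cyclic_periodic cR Rr); rewrite -modnDml subnKC ?modnn ?mod0n //.
  by apply: ltnW; rewrite ltn_mod prime_gt0.
left; apply: (constant_in_subuniverse _ UT Rr0).
  move=> f x hx; have /choice [r hr] i : exists r, R r /\ r 0 = x i.
    by have := hx i; rewrite inE => /asboolP.
  rewrite inE; apply/asboolP; exists (fun k => op f [ffun i => r i k]).
  split; first by apply: cpR => i; case: (hr i).
  by congr op; apply/ffunP => i; rewrite ffunE; case: (hr i).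
move=> i; rewrite inE; apply/asboolP; exists (fun k => r0 (k + i)).
by split; first exact: cyclic_shift cR Rr0.
Qed.

(** Coordinates are moved into an absorbing [U] one at a time: the binary term combines a tuple
    whose first [m] entries lie in [U] with one whose entry at [m] does. *)
Lemma constant_or_absorption_free :
  (exists a, R (fun=> a)) \/ binary_absorption_free A.
Proof.
have [|sd] := constant_or_subdirect; [by left|].
have [|nex] := pselect (exists a, R (fun=> a)); [by left|right].
move=> U subU /set0Pn [u uU] [b hb]; apply/eqP/negPn/negP => UT.
apply: nex.
suff [r [Rr rU]] : exists r, R r /\ forall i, i < p -> r i \in U.
  apply: (constant_in_subuniverse subU UT Rr) => i.
  rewrite (@cyclic_periodic _ p _ R r i (i %% p)) ?modn_mod //.
  by apply: rU; rewrite ltn_mod prime_gt0.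
elim: p => [|m [r [Rr rU]]].
  by have [_ [r Rr] _ _] := cR; exists r.
have [r' [Rr' r'm]] := sd m u; have [cpR _ _ _] := cR.
exists (fun k => teval b (fun z => (if z then r else r') k)); split.
  by apply: (@compatible_teval _ _ _ R _ b (fun z : bool => if z then r else r')) => // -[].
move=> i; rewrite ltnS leq_eqVlt => /predU1P[->|/rU riU].
  by apply: (hb false); rewrite r'm.
exact: (hb true).
Qed.

(** A constant tuple in the quotient comes from a tuple of [R] inside a single congruence class,
    which is a proper subuniverse. *)
Lemma constant_or_simple : (exists a, R (fun=> a)) \/ simple_alg A.
Proof.
have [|nex] := pselect (exists a, R (fun=> a)); [by left|right].
move=> Q conQ; apply: contrapT => /not_orP [neq nfull]; apply: nex.
move: neq => /existsNP [x /existsNP [y /not_implyP [Qxy ne]]].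
pose h := quot_proj conQ; have hh : @is_hom S A (quot_alg conQ) h := quot_proj_hom conQ.
have tB : taylor (quot_alg conQ).
  by apply: taylor_transfer tA => l r; apply: (identity_surj hh); exact: quot_proj_surj.
have [cpR [r0 Rr0] per sh] := cR.
have cR' : cyclic_relation p (fun s : nat -> quot_alg conQ => exists r, R r /\ s = h \o r).
  split.
  - move=> f s /choice [r hr]; exists (fun k => op f [ffun i => r i k]).
    split; first by apply: cpR => i; case: (hr i).
    apply: funext => k; rewrite [RHS]hh; congr (@op S (quot_alg conQ) f _).
    by apply/ffunP => i; rewrite !ffunE; case: (hr i) => _ ->.
  - by exists (h \o r0), r0.
  - by move=> _ [r [Rr ->]] i /=; rewrite per.
  - by move=> _ [r [Rr ->]]; exists (fun i => r i.+1); split; first exact: sh.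
have [b [r [Rr /funeqP hr]]] := constant_of_smaller tB (card_quot_alg conQ Qxy ne) cR'.
apply: (@constant_in_subuniverse [set a | h a == b] r) => //.
- move=> f u hu; rewrite inE hh -[X in _ == X](@op_idem S (quot_alg conQ) f).
  apply/eqP; congr (@op S (quot_alg conQ) f _).
  by apply/ffunP => i; rewrite !ffunE; have := hu i; rewrite inE => /eqP.
- apply/eqP => e; apply: nfull => u v; apply/(quot_proj_eq conQ).
  have := in_setT u; have := in_setT v; rewrite -e !inE.
  by move=> /eqP hv /eqP hu; rewrite -/h hu hv.
- by move=> i; rewrite inE -[h _]/((h \o r) i) -hr.
Qed.

Section TernaryAbsorption.
Hypothesis simA : simple_alg A.
Hypothesis sdR : forall i a, exists r, R r /\ r i = a.

(** By shift invariance this is also the projection of [R] to the coordinates [i] and [i + k], for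
    every [i]. *)
Definition link k (a b : A) : Prop := exists r, [/\ R r, r 0 = a & r k = b].

Lemma link_compatible k : compatible2 (link k).
Proof.
move=> f x y /choice [r hr]; have [cpR _ _ _] := cR.
exists (fun j => op f [ffun i => r i j]); split.
- by apply: cpR => i; case: (hr i).
- by congr op; apply/ffunP => i; rewrite ffunE; case: (hr i).
- by congr op; apply/ffunP => i; rewrite ffunE; case: (hr i).
Qed.

Definition link_image k (C : {set A}) : {set A} :=
  [set b | `[< exists a, a \in C /\ link k a b >]].

Lemma link_imageP k (C : {set A}) r : R r -> r 0 \in C -> r k \in link_image k C.
Proof.
by move=> Rr rC; rewrite inE; apply/asboolP; exists (r 0); split=> //; exists r.
Qed.

Lemma link_image_subuniverse k (C : {set A}) : subuniverse C -> subuniverse (link_image k C).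
Proof.
move=> subC f x hx; have /choice [y hy] i : exists a, a \in C /\ link k a (x i).
  by have := hx i; rewrite inE => /asboolP.
rewrite inE; apply/asboolP; exists (op f [ffun i => y i]); split.
  by apply: subC => i; rewrite ffunE; case: (hy i).
by apply: link_compatible => i; rewrite ffunE; case: (hy i).
Qed.

Lemma link_image_ternary k (C : {set A}) :
  ternary_absorbing C -> ternary_absorbing (link_image k C).
Proof.
apply: (@ternary_preimage _ A A (fun b a => link k a b)).
  by move=> f x y; exact: link_compatible.
by move=> b; have [r [Rr rk]] := sdR k b; exists (r 0), r.
Qed.

Lemma link_image_neq0 k (C : {set A}) : C != set0 -> link_image k C != set0.
Proof.
case/set0Pn => a aC; have [r [Rr r0]] := sdR 0 a; apply/set0Pn; exists (r k).
by apply: link_imageP; rewrite ?r0.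
Qed.

(* If one coordinate is determined by another, then, [p] being prime, every
   coordinate determines all the others. *)
Lemma link_injective_constant k :
  ~~ (p %| k) -> (forall a a' b, link k a b -> link k a' b -> a = a') ->
  exists a, R (fun=> a).
Proof.
move=> pk inj; have p_gt0 := prime_gt0 p_prime.
have [q kq] : exists q, (k + q) %% p = 0.
  exists (p - k %% p); rewrite -modnDml subnKC ?modnn //.
  by apply: ltnW; rewrite ltn_mod.
(* Since [p] divides [k + q], the coordinates [j.+1 * q] and [j * q] are joined by [link k], and
   injectivity determines the former from the latter. *)
have det r r' j : R r -> R r' -> r 0 = r' 0 -> r (j * q) = r' (j * q).
  move=> Rr Rr' e; elim: j => // j IH.
  have step (s : nat -> A) : R s -> link k (s (j.+1 * q)) (s (j * q)).
    move=> Rs; exists (fun i => s (i + j.+1 * q)); split=> //.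
      exact: cyclic_shift cR Rs.
    by apply: (cyclic_periodic cR Rs); rewrite mulSn addnA -modnDml kq.
  by apply: inj (step r Rr) _; rewrite IH; exact: step.
apply: (@graph_constant _ _ p_prime _ R [set Ordinal p_gt0]) => //.
  move=> g; have [r [Rr r0]] := sdR 0 (g (Ordinal p_gt0)); exists r; split=> //.
  by move=> i; rewrite inE => /eqP ->.
move=> r r' Rr Rr' /(_ (Ordinal p_gt0)); rewrite inE eqxx => /(_ isT) /= e i.
have pq : ~~ (p %| q).
  by apply: contra pk => pq; rewrite -(dvdn_addl k pq) /dvdn kq.
have q_gt0 : 0 < q by case: q pq {kq det} => //; rewrite dvdn0.
(* [q] is invertible modulo [p], so its multiples run through all coordinates. *)
have [j ej] : exists j, i = j * q %[mod p].
  case: (egcdnP p q_gt0) => u v uv _; exists (i * u).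
  have cop : gcdn q p = 1 by apply/eqP; rewrite -/(coprime q p) coprime_sym prime_coprime.
  by rewrite -mulnA uv cop mulnDr muln1 mulnA modnMDl.
by rewrite (cyclic_periodic cR Rr ej) (cyclic_periodic cR Rr' ej) (det r r').
Qed.

(** The number is the total shift along a sequence of link images. Only proper images are followed,
    which keeps properness along the chain. *)
Inductive chain : {set A} -> {set A} -> nat -> Prop :=
  | Chain0 C : chain C C 0
  | ChainS C D s k : chain C D s -> link_image k D != setT ->
      chain C (link_image k D) (s + k).

Lemma chain_trans (C D F : {set A}) s s' :
  chain C D s -> chain D F s' -> chain C F (s + s').
Proof.
move=> CD DF; elim: DF CD => {D F s'} [D|D F s' k _ IH ne] CD; first by rewrite addn0.
by rewrite addnA; apply: ChainS => //; exact: IH.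
Qed.

Lemma chain_mem (C D : {set A}) s r : chain C D s -> R r -> r 0 \in C -> r s \in D.
Proof.
move=> CD Rr; elim: CD => {C D s} // C D s k _ IH _ rC.
have := @link_imageP k D _ (cyclic_shift s cR Rr) (IH rC).
by rewrite addnC.
Qed.

Lemma chain_loop (C : {set A}) s j : chain C C s -> chain C C (j * s).
Proof.
move=> Cs; elim: j => [|j IH]; first exact: Chain0.
by rewrite mulSn; exact: chain_trans IH.
Qed.

Definition proper_ternary (C : {set A}) : Prop :=
  [/\ subuniverse C, C != set0, C != setT & ternary_absorbing C].

Lemma chain_proper_ternary (C D : {set A}) s :
  proper_ternary C -> chain C D s -> proper_ternary D.
Proof.
move=> pC CD; elim: CD pC => // {C D s} C D s k _ IH ne /IH [subD D0 _ stD].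
split=> //; [exact: link_image_subuniverse|exact: link_image_neq0|].
exact: link_image_ternary.
Qed.

(** [D] is chosen with the fewest sets reachable from it; everything reachable from [D] then reaches
    the same sets, [D] among them. *)
Lemma terminal_ternary (C : {set A}) : proper_ternary C ->
  exists2 D, proper_ternary D &
    forall F s, chain D F s -> exists s', chain F D s'.
Proof.
move=> pC.
pose reach (D : {set A}) : {set {set A}} := [set F | `[< exists s, chain D F s >]].
pose Pb : pred {set A} := fun D : {set A} => `[< proper_ternary D >].
have PC : Pb C by apply/asboolP.
have [D /asboolP pD minD] := arg_minnP (fun D => #|reach D|) PC.
exists D => // F s DF.
have sub : reach F \subset reach D.
  apply/subsetP => H; rewrite !inE => /asboolP [s' FH]; apply/asboolP.
  by exists (s + s'); exact: chain_trans FH.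
have PF : Pb F by apply/asboolP; exact: chain_proper_ternary DF.
have /eqP e : reach F == reach D by rewrite eqEcard sub minD.
have : D \in reach F by rewrite e inE; apply/asboolP; exists 0; exact: Chain0.
by rewrite inE => /asboolP.
Qed.

Lemma coprime_solve u k : coprime p u -> exists j, p %| j * u + k.
Proof.
move=> cop; have u_gt0 : 0 < u.
  by case: u cop => //; rewrite /coprime gcdn0 => /eqP e; move: p_prime; rewrite e.
case: (egcdnP p u_gt0) => a b ab _.
have g1 : gcdn u p = 1 by apply/eqP; rewrite gcdnC.
exists (k * p.-1 * a); rewrite -mulnA ab g1 mulnDr muln1 -addnA.
have -> : k * p.-1 + k = k * p by rewrite -mulnSr prednK // prime_gt0.
by rewrite dvdn_add // ?dvdn_mull // mulnA dvdn_mull.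
Qed.

(* Following the chains from [C] to [D] and back, either the total shift is
   invertible modulo [p] and [C] is contained in [D], or membership in [C] and
   in [D] are equivalent along the link, which therefore is not linked. *)
Lemma terminal_meet (C : {set A}) k :
  proper_ternary C -> (forall F s, chain C F s -> exists s', chain F C s') ->
  (exists a, R (fun=> a)) \/ exists r, [/\ R r, r 0 \in C & r k \in C].
Proof.
move=> [subC C0 CT stC] term.
have [a aC] := set0Pn _ C0.
suff [|sub] : (exists a, R (fun=> a)) \/ (forall r, R r -> r 0 \in C -> r 0 \in link_image k C).
- by left.
- have [r [Rr r0]] := sdR 0 a; right; have := sub r Rr.
  rewrite r0 => /(_ aC); rewrite inE => /asboolP [b [bC [r' [Rr' e0 ek]]]].
  by exists r'; rewrite e0 ek.
have [full|ne] := eqVneq (link_image k C) setT.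
  by right=> r _ _; rewrite full.
have CD : chain C (link_image k C) k by apply: (ChainS (s := 0)) ne; exact: Chain0.
have [s DC] := term _ _ CD.
have [pu|pu] := boolP (p %| k + s); last first.
  (* After [j] loops and one more step by [k] the total shift is divisible by [p], so the chain ends
     at the coordinate where it began. *)
  right=> r Rr rC; have [|j pj] := @coprime_solve (k + s) k; first by rewrite prime_coprime.
  have CjD := chain_trans (chain_loop j (chain_trans CD DC)) CD.
  have := chain_mem CjD Rr rC.
  by rewrite (@cyclic_periodic _ p _ _ r _ 0 cR Rr) // mod0n; apply/eqP.
have [pk|pk] := boolP (p %| k).
  right=> r Rr rC; have := @link_imageP k C r Rr rC.
  by rewrite (@cyclic_periodic _ p _ _ r k 0 cR Rr) // mod0n; apply/eqP.
left; apply: (link_injective_constant pk).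
(* As [p] divides [k + s], a tuple whose entry at [k] lies in the image of [C] has its entry at [0]
   in [C]. So [C] is closed under [L] and under the congruence [Q] above it; [Q] is not full, and
   simplicity makes it equality and the link injective. *)
pose L x y := exists b, link k x b /\ link k y b.
have [|||Q [cQ LQ QU]] := @tolerance_congruence _ A L.
- apply: (@compatible2_comp _ _ _ _ (link k) (fun b y => link k y b)).
    exact: link_compatible.
  by move=> f x y h; apply: link_compatible => i; exact: h.
- by move=> x; have [r [Rr <-]] := sdR 0 x; exists (r k); split; exists r.
- by move=> x y [b [xb yb]]; exists b.
have Lmem x y : L x y -> x \in C -> y \in C.
  case=> b [[r [Rr <- rk]] [r' [Rr' <- r'k]]] rC.
  have := @link_imageP k C r Rr rC; rewrite rk -r'k => r'D.
  have := chain_mem DC (cyclic_shift k cR Rr') r'D.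
  rewrite (@cyclic_periodic _ p _ _ r' (s + k) 0 cR Rr') // mod0n addnC.
  exact/eqP.
have [eqQ|fullQ] := simA cQ.
  by move=> x y b xb yb; apply/eqQ/LQ; exists b.
case/eqP: CT; apply/setP => x; rewrite inE.
exact: QU Lmem _ _ (fullQ a x) aC.
Qed.

(** Some tuple meets a terminal [D] at any two given coordinates. This extends to larger sets of
    coordinates by induction: a first failure on [J] would make the projection of [R] to [J] an
    essential relation of arity at least 3. *)
Lemma constant_of_proper_ternary (C : {set A}) :
  proper_ternary C -> exists a, R (fun=> a).
Proof.
move=> /terminal_ternary [D pD term]; have [subD D0 DT stD] := pD.
have [|nex] := pselect (exists a, R (fun=> a)); first by [].
have p_gt0 := prime_gt0 p_prime; have [cpR [r0 Rr0] _ _] := cR.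
have pairs i j : i < p -> exists r, [/\ R r, r i \in D & r j \in D].
  move=> ip; have [//|[r [Rr rD rk]]] := terminal_meet (j + (p - i)) pD term.
  exists (fun n => r (n + (p - i))); split=> //; first exact: cyclic_shift cR Rr.
  rewrite subnKC ?(ltnW ip) //.
  by rewrite (@cyclic_periodic _ p _ _ r p 0 cR Rr) // modnn mod0n.
suff [r [Rr rD]] : exists r, R r /\ forall i : 'I_p, i \in setT -> r i \in D.
  apply: (constant_in_subuniverse subD DT Rr) => i.
  rewrite (@cyclic_periodic _ p _ R r i (i %% p)) ?modn_mod //.
  have lt : i %% p < p by rewrite ltn_mod.
  exact: (rD (Ordinal lt)).
move: [set: 'I_p] => J; move: {2}_.+1 (ltnSn #|J|) => m.
elim: m J => // m IH J lem.
have [le2|gt2] := leqP #|J| 2.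
  have [->|[i iJ]] := set_0Vmem J; first by exists r0; split=> // i; rewrite inE.
  have [j hj] : exists j, forall l, l \in J -> l = i \/ l = j.
    have [J0|[j]] := set_0Vmem (J :\ i).
      exists i => l lJ; left; apply/eqP/negPn/negP => li.
      by have := in_set0 l; rewrite -J0 !inE li lJ.
    rewrite !inE => /andP[ji jJ]; exists j => l lJ.
    have [->|li] := eqVneq l i; [by left|right].
    apply/eqP/negPn/negP => lj; move: le2; rewrite leqNgt => /negP; apply.
    by apply/card_gt2P; exists i, j, l; rewrite iJ jJ lJ eq_sym ji eq_sym lj li.
  have [r [Rr ri rj]] := pairs i j (ltn_ord i).
  by exists r; split=> // l /hj [] ->.
apply: contrapT => none.
pose K := {i : 'I_p | i \in J}.
apply: (stD K (fun u => exists r, R r /\ u = fun i : K => r (val i : 'I_p))).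
  by rewrite card_sig.
split.
- move=> f x /choice [r hr]; exists (fun n => op f [ffun i => r i n]); split.
    by apply: cpR => i; case: (hr i).
  apply: funext => l; congr op; apply/ffunP => i; rewrite !ffunE.
  by case: (hr i) => _ ->.
- move=> i; have [|r [Rr rD]] := IH (J :\ val i).
    by rewrite ltnS in lem; apply: leq_trans lem; rewrite [X in _ < X](cardsD1 (val i)) (valP i).
  exists (fun l : K => r (val l : 'I_p)); split; first by exists r.
  move=> l ne; apply: rD; rewrite !inE (valP l) andbT.
  by apply/eqP => /val_inj.
- case=> u [[r [Rr ->]] rD]; apply: none; exists r; split=> // i iJ.
  exact: (rD (Sub i iJ)).
Qed.

End TernaryAbsorption.
End CyclicConstant.

(** For a maximal [J] with [R] projecting onto [A ^ J], another coordinate [i] is a function of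
    those in [J]. Otherwise the tolerance of sharing the entries on [J] is full, some assignment on
    [J] allows every value at [i], and then all assignments do, against maximality. *)
Lemma constant_of_ternary_free (S : signature) (p : nat) (A : algebra S)
    (R : (nat -> A) -> Prop) :
  prime p -> #|A| < p -> taylor A -> cyclic_relation p R ->
  simple_alg A -> binary_absorption_free A -> ternary_free A ->
  (forall i a, exists r, R r /\ r i = a) -> exists a, R (fun=> a).
Proof.
move=> p_prime ltp tA cR simA fA sA sdR; have [cpR _ _ _] := cR.
have p_gt0 := prime_gt0 p_prime.
pose full (J : {set 'I_p}) :=
  forall g : 'I_p -> A, exists r, R r /\ forall i, i \in J -> r i = g i.
pose fullb : pred {set 'I_p} := fun J => `[< full J >].
have full0 : fullb set0.
  apply/asboolP => g; have [_ [r Rr] _ _] := cR; exists r; split=> // i.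
  by rewrite inE.
have [J /asboolP fullJ maxJ] := arg_maxnP (fun J : {set 'I_p} => #|J|) full0.
apply: (graph_constant p_prime ltp cR fullJ) => r r' Rr Rr' rr' n.
rewrite (@cyclic_periodic _ p _ R r n (n %% p)) ?modn_mod //.
rewrite (@cyclic_periodic _ p _ R r' n (n %% p)) ?modn_mod //.
have lt : n %% p < p by rewrite ltn_mod.
have [i -> {lt}] : exists i : 'I_p, n %% p = i by exists (Ordinal lt).
have [/rr' //|iJ] := boolP (i \in J).
pose W (y : A) (e : pow_alg A p) :=
  exists r, [/\ R r, forall j, j \in J -> r j = e j & r i = y].
have cW : compatible2 W.
  move=> f x y /choice [s hs]; exists (fun k => op f [ffun l => s l k]); split.
  - by apply: cpR => l; case: (hs l).
  - move=> j jJ; rewrite ffunE; congr op; apply/ffunP => l; rewrite !ffunE.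
    by have [_ sl _] := hs l; exact: sl.
  - by congr op; apply/ffunP => l; rewrite ffunE; case: (hs l).
have totW e : exists y, W y e.
  by have [s [Rs se]] := fullJ e; exists (s i), s.
pose L y y' := exists e, W y e /\ W y' e.
have ext (s : nat -> A) : R s -> W (s i) [ffun j : 'I_p => s j].
  by move=> Rs; exists s; split=> // j _; rewrite ffunE.
have [nL|/existsNP nL] := pselect (forall y y', L y y' -> y = y').
  apply: nL; exists [ffun j : 'I_p => r j]; split; first exact: ext.
  by exists r'; split=> // j jJ; rewrite ffunE rr'.
exfalso.
have fullL : forall y y', L y y'.
  apply: tolerance_full => //.
  - apply: (@compatible2_comp _ _ _ _ W (fun e y => W y e)) => // f x y h.
    by apply: cW => l; exact: h.
  - by move=> y; have [s [Rs <-]] := sdR i y; exists [ffun j : 'I_p => s j]; split; exact: ext.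
  - by move=> x y [e [xe ye]]; exists e.
  - by case: nL => y /existsNP [y' /not_implyP [Lyy ne]]; exists y, y'.
have tE : taylor (pow_alg A p).
  by apply: taylor_transfer tA => l u; exact: identity_pow.
have [e0 We0] := common_neighbour tE fA sA cW fullL.
have [g ng] : exists g : 'I_p -> A, ~ exists r, R r /\ forall j, j \in i |: J -> r j = g j.
  apply/existsNP => fulliJ; have : fullb (i |: J) by apply/asboolP.
  by move/maxJ; rewrite cardsU1 iJ add1n /= ltnn.
(* Hybrids leading from [e0] to [g], one coordinate at a time. *)
pose e k : pow_alg A p := [ffun j : 'I_p => if j < k then g j else e0 j].
suff We k : k <= p -> forall y, W y (e k).
  have [s [Rs sg si]] := We p (leqnn p) (g i).
  apply: ng; exists s; split=> // j; rewrite !inE => /predU1P[->//|/sg ->].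
  by rewrite ffunE ltn_ord.
elim: k => [_ y|k IH ltk y].
  suff -> : e 0 = e0 by [].
  by apply/ffunP => j; rewrite ffunE ltn0.
pose ko := Ordinal ltk.
pose V (x : A) (z : A) := W z [ffun j : 'I_p => if j == ko then x else e k j].
have cV : compatible2 V.
  move=> f x z h; rewrite /V.
  have -> : [ffun j : 'I_p => if j == ko then op f x else e k j] =
      op f [ffun l => ([ffun j : 'I_p => if j == ko then x l else e k j]
                       : pow_alg A p)] :> pow_alg A p.
    apply/ffunP => j; rewrite [RHS]ffunE ffunE; case: (eqVneq j ko) => [jk|jk].
      by congr op; apply/ffunP => l; rewrite !ffunE jk eqxx.
    rewrite -[LHS](op_idem f); congr op; apply/ffunP => l.
    by rewrite !ffunE (negbTE jk).
  by apply: cW => l; rewrite ffunE; exact: h.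
(* The entry of the current hybrid at [ko] is central, so the center is nonempty and every entry may
   replace it. *)
have CT : center V = setT.
  apply: sA (center_subuniverse cV) _ (center_ternary cV _ tA fA).
    apply/set0Pn; exists (e k ko); apply/centerP => z; rewrite /V.
    suff -> : [ffun j : 'I_p => if j == ko then e k ko else e k j] = e k.
      by apply: IH; exact: ltnW.
    by apply/ffunP => j; rewrite ffunE; case: eqP => [->|].
  by move=> x; exact: totW.
have /centerP/(_ y) : g ko \in center V by rewrite CT.
rewrite /V; congr W; apply/ffunP => j; rewrite !ffunE ltnS [in RHS]leq_eqVlt.
by rewrite -val_eqE /=; case: eqP => [jk|//]; congr (g _); apply: ord_inj.
Qed.

Theorem cyclic_relation_constant (S : signature) (p : nat) (A : algebra S)
    (R : (nat -> A) -> Prop) :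
  prime p -> #|A| < p -> taylor A -> cyclic_relation p R ->
  exists a, R (fun=> a).
Proof.
move=> p_prime; move: {2}_.+1 (ltnSn #|A|) => m.
elim: m A R => // m IH A R lem ltp tA cR.
have smaller (B : algebra S) : taylor B -> #|B| < #|A| ->
    forall R' : (nat -> B) -> Prop, cyclic_relation p R' -> exists b, R' (fun=> b).
  move=> tB ltB R' cR'; apply: IH => //; last exact: ltn_trans ltp.
  by rewrite ltnS in lem; exact: leq_trans lem.
have [//|sdR] := constant_or_subdirect p_prime cR smaller tA.
have [//|fA] := constant_or_absorption_free p_prime cR smaller tA.
have [//|simA] := constant_or_simple cR smaller tA.
have [sA|] := pselect (ternary_free A); 
  first exact: (constant_of_ternary_free p_prime ltp tA cR simA fA sA sdR).
move=> /existsNP [C /not_implyP [subC /not_implyP [C0 /not_implyP [stC /eqP CT]]]].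
exact: (@constant_of_proper_ternary _ _ _ _ p_prime cR smaller tA ltp simA sdR C).
Qed.

(** * Cyclic terms *)

Definition rot_ord n k (i : 'I_n) : 'I_n :=
  Ordinal (ltn_pmod (i + k) (leq_ltn_trans (leq0n i) (ltn_ord i))).

Lemma rot_ordD n k l (i : 'I_n) : rot_ord k (rot_ord l i) = rot_ord (l + k) i.
Proof. by apply: val_inj; rewrite /= modnDml addnA. Qed.

Lemma rot_ord_mod n k l (i : 'I_n) :
  k = l %[mod n] -> rot_ord k i = rot_ord l i.
Proof. by move=> e; apply: val_inj; rewrite /= -modnDmr e modnDmr. Qed.

Lemma rot_ord0 n (i : 'I_n) : rot_ord 0 i = i.
Proof. by apply: val_inj; rewrite /= addn0 modn_small. Qed.

Lemma ordS_rot n (i : 'I_n) : ordS i = rot_ord 1 i.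
Proof. by apply: val_inj; rewrite /= addn1. Qed.

Lemma rot_ord_inj n k : injective (@rot_ord n k).
Proof.
apply: (can_inj (g := rot_ord (n - k %% n))) => i.
rewrite rot_ordD (@rot_ord_mod _ _ 0) ?rot_ord0 //.
rewrite -modnDml subnKC ?modnn ?mod0n // ltnW // ltn_mod.
exact: leq_ltn_trans (ltn_ord i).
Qed.

(** [h] is applied to the values of [c] on all cyclic shifts of the arguments; shifting the
    arguments then only shifts the inputs of [h]. *)
Definition convolution (S : signature) (n : nat) (h c : nterm S n) : nterm S n :=
  subst h (fun i => subst c (fun j => Var S (rot_ord i j))).

Lemma teval_convolution (S : signature) (n : nat) (A : algebra S)
    (h c : nterm S n) (x : 'I_n -> A) :
  teval (convolution h c) x = teval h (fun i : 'I_n => teval c (x \o rot_ord i)).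
Proof.
by rewrite teval_subst; apply: teval_ext => i; rewrite teval_subst.
Qed.

Lemma teval_convolution_rot (S : signature) (n : nat) (A : algebra S)
    (h c : nterm S n) (x : 'I_n -> A) k :
  teval (convolution h c) (x \o rot_ord k) =
  teval h (fun i : 'I_n => teval c (x \o rot_ord (i + k))).
Proof.
rewrite teval_convolution; apply: teval_ext => i; apply: teval_ext => j /=.
by rewrite rot_ordD.
Qed.

(* A tuple is made cyclically invariant by composing with a term whose values
   on the shifts of the tuple are constant. *)
Lemma taylor_cyclic_term (S : signature) (p : nat) (A : algebra S) :
  prime p -> #|A| < p -> taylor A ->
  exists c : nterm S p, forall x : 'I_p -> A,
    teval c x = teval c (fun i => x (ordS i)).
Proof.
move=> p_prime ltp tA; have p_gt0 := prime_gt0 p_prime.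
pose good (c : nterm S p) (x : 'I_p -> A) :=
  forall k, teval c (x \o rot_ord k) = teval c x.
suff [c hc] : exists c, forall x : {ffun 'I_p -> A}, x \in enum {ffun 'I_p -> A} -> good c x.
  exists c => x; have xE : x = [ffun i => x i] by apply: funext => i; rewrite ffunE.
  rewrite xE -(hc [ffun i => x i] _ 1) ?mem_enum //; apply: teval_ext => i /=.
  by rewrite ordS_rot.
elim: (enum _) => [|b s [c hc]]; first by exists (Var S (Ordinal p_gt0)).
pose b' k := teval c (b \o rot_ord k).
have b'm k l : k = l %[mod p] -> b' k = b' l.
  by move=> e; apply: teval_ext => i /=; rewrite (rot_ord_mod _ e).
(* The relation generated by the shifts of [b']. A constant tuple in it provides an [h] whose
   convolution with [c] is shift invariant at [b]. *)
pose R (r : nat -> A) :=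
  exists h : nterm S p, r = fun k => teval h (fun i : 'I_p => b' (i + k)).
have cR : cyclic_relation p R.
  split.
  - move=> f x /choice [h hh]; exists (App h); apply: funext => k.
    by rewrite teval_App; congr op; apply/ffunP => i; rewrite !ffunE hh.
  - pose h := Var S (Ordinal p_gt0).
    by exists (fun k => teval h (fun i : 'I_p => b' (i + k))), h.
  - move=> _ [h ->] k; apply: teval_ext => i.
    by apply: b'm; rewrite addnA modnDr.
  - move=> _ [h ->].
    exists (subst h (fun i => Var S (rot_ord 1 i))); apply: funext => k.
    rewrite teval_subst; apply: teval_ext => i /=.
    by apply: b'm; rewrite modnDml addn1 addSnnS.
have [a [h /funeqP ha]] := cyclic_relation_constant p_prime ltp tA cR.
exists (convolution h c) => x; rewrite inE => /predU1P[->|xs] k.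
  have dk l : teval (convolution h c) (b \o rot_ord l) = a.
    by rewrite teval_convolution_rot; exact: esym (ha l).
  rewrite dk -(dk 0); apply: teval_ext => i /=.
  by rewrite rot_ord0.
have gx := hc x xs; rewrite teval_convolution_rot teval_convolution.
by apply: teval_ext => i; rewrite !gx.
Qed.

(** * Edges as term digraphs *)

Section Generation.
Variable S : signature.
Implicit Types A B C : algebra S.

Definition pair_val (T : Type) (a b : T) (z : 'I_2) : T :=
  if z == ord0 then a else b.

Lemma tnth2 (T : Type) (a b : T) : tnth [tuple a; b] = pair_val a b.
Proof. by apply: funext; case=> -[|[|k]] lt. Qed.

Lemma comp_pair_val (T T' : Type) (f : T -> T') (a b : T) :
  f \o pair_val a b = pair_val (f a) (f b).
Proof. by apply: funext => z /=; rewrite /pair_val; case: eqP. Qed.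

Lemma Sg_subuniverse A (X : {set A}) : subuniverse (Sg X).
Proof.
move=> f x hx; apply/bigcapP => U /andP[/asboolP subU XU].
apply: (subU) => i; have /bigcapP/(_ U) := hx i; apply.
by rewrite XU andbT; apply/asboolP.
Qed.

Lemma sub_Sg A (X : {set A}) : X \subset Sg X.
Proof. by apply/bigcapsP => U /andP[]. Qed.

Lemma Sg_min A (X U : {set A}) : subuniverse U -> X \subset U -> Sg X \subset U.
Proof. by move=> subU XU; apply: bigcap_inf; rewrite XU andbT; apply/asboolP. Qed.

Lemma Sg2_min A (U : {set A}) a b :
  subuniverse U -> a \in U -> b \in U -> Sg [set a; b] \subset U.
Proof.
by move=> subU aU bU; apply: Sg_min => //; apply/subsetP => x; rewrite !inE => /orP[] /eqP ->.
Qed.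

Lemma Sg2_l A (a b : A) : a \in Sg [set a; b].
Proof. by apply: (subsetP (sub_Sg _)); rewrite !inE eqxx. Qed.

Lemma Sg2_r A (a b : A) : b \in Sg [set a; b].
Proof. by apply: (subsetP (sub_Sg _)); rewrite !inE eqxx orbT. Qed.

Lemma Sg2_teval A (a b : A) (s : nterm S 2) : teval s (pair_val a b) \in Sg [set a; b].
Proof.
apply: subuniverse_teval; first exact: Sg_subuniverse.
by move=> z; rewrite /pair_val; case: eqP; rewrite ?Sg2_l ?Sg2_r.
Qed.

Lemma Sg2P A (a b x : A) :
  x \in Sg [set a; b] -> exists s : nterm S 2, x = teval s (pair_val a b).
Proof.
pose U : {set A} := [set x | `[< exists s : nterm S 2, x = teval s (pair_val a b) >]].
have subU : subuniverse U.
  move=> f y hy; have /choice [s hs] i : exists s : nterm S 2, y i = teval s (pair_val a b).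
    by have := hy i; rewrite inE => /asboolP.
  rewrite inE; apply/asboolP; exists (App s); rewrite teval_App.
  by congr op; apply/ffunP => i; rewrite ffunE.
have aU : a \in U by rewrite inE; apply/asboolP; exists (Var S ord0).
have bU : b \in U by rewrite inE; apply/asboolP; exists (Var S ord_max).
by move=> /(subsetP (Sg2_min subU aU bU)); rewrite inE => /asboolP.
Qed.

(** The common shape of both edge relations; the homomorphism axioms hold for every digraph of this
    shape. *)
Definition term_digraph (T : nterm S 2 -> Prop) : digraphs S :=
  fun A a b => forall s, T s -> b \in Sg [set a; teval s (pair_val a b)].

Lemma term_digraph_hom (T : nterm S 2 -> Prop) A B (f : A -> B) (a b : A) :
  is_hom f -> term_digraph T a b -> term_digraph T (f a) (f b).
Proof.
move=> hf Tab s Ts; have [u bu] := Sg2P (Tab s Ts); rewrite {1}bu.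
rewrite (hom_teval u _ hf) comp_pair_val (hom_teval s _ hf) comp_pair_val.
exact: Sg2_teval.
Qed.

(** The term producing [f b] downstairs, evaluated upstairs at [a] and [d], gives an element over
    [f b]. With [a] it generates a subuniverse of [Sg [set a; d]], hence of [Sg [set a; b']], and
    minimality forces equality. *)
Lemma term_digraph_lift (T : nterm S 2 -> Prop) A B (f : A -> B) (a b b' : A) :
  is_hom f -> term_digraph T (f a) (f b) -> f b' = f b ->
  (forall c : A, f c = f b -> Sg [set a; c] \subset Sg [set a; b'] ->
     Sg [set a; c] = Sg [set a; b']) ->
  term_digraph T a b'.
Proof.
move=> hf Tab fb' minb' s Ts; set d := teval s _.
have [u fu] := Sg2P (Tab s Ts).
have fe : f (teval u (pair_val a d)) = f b.
  by rewrite hom_teval // comp_pair_val /d hom_teval // comp_pair_val fb' -fu.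
have ed : teval u (pair_val a d) \in Sg [set a; d] := Sg2_teval _ _ _.
have db : d \in Sg [set a; b'] := Sg2_teval _ _ _.
have sub1 : Sg [set a; d] \subset Sg [set a; b'].
  by apply: Sg2_min (Sg2_l _ _) db; exact: Sg_subuniverse.
have sub2 : Sg [set a; teval u (pair_val a d)] \subset Sg [set a; d].
  by apply: Sg2_min (Sg2_l _ _) ed; exact: Sg_subuniverse.
apply: (subsetP sub2); rewrite (minb' _ fe); first exact: Sg2_r.
exact: subset_trans sub2 sub1.
Qed.

Variable V : algebra S -> Prop.

Definition as_term (s : nterm S 2) : Prop :=
  exists n (c : nterm S n), cyclic_term V c /\
    s = subst c (fun i => Var S (if i.+1 == n then ord_max else ord0)).

Definition sm_term (s : nterm S 2) : Prop :=
  exists (t : nterm S 2) n (c : nterm S n) k,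
    [/\ cyclic_term V c, 0 < k, k.*2 <= n &
        s = subst t (pair_val (Var S ord_max)
          (subst c (fun i : 'I_n => Var S (if i < k then ord0 else ord_max))))].

Lemma as_termE n (c : nterm S n) A (a b : A) :
  teval (subst c (fun i => Var S (if i.+1 == n then ord_max else ord0))) (pair_val a b)
  = teval c (fun i => if i.+1 == n then b else a).
Proof. by rewrite teval_subst; apply: teval_ext => i /=; case: eqP. Qed.

Lemma sm_termE (t : nterm S 2) n (c : nterm S n) k A (a b : A) :
  teval (subst t (pair_val (Var S ord_max)
    (subst c (fun i : 'I_n => Var S (if i < k then ord0 else ord_max))))) (pair_val a b)
  = teval t (pair_val b (teval c (fun i => if i < k then a else b))).
Proof.
rewrite teval_subst; apply: teval_ext => z; rewrite /pair_val; case: eqP => // _.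
by rewrite teval_subst; apply: teval_ext => i /=; case: ltnP.
Qed.

Lemma as_ZE A (a b : A) : as_Z V a b <-> term_digraph as_term a b.
Proof.
split.
  by move=> h s [n [c [cc ->]]]; rewrite as_termE; exact: h.
move=> h n c cc; rewrite -as_termE; apply: h; by exists n, c.
Qed.

Lemma sm_ZE A (a b : A) : sm_Z V a b <-> term_digraph sm_term a b.
Proof.
split.
  by move=> h s [t [n [c [k [cc k0 kn ->]]]]]; rewrite sm_termE -tnth2; exact: h.
move=> h t n c k cc k0 kn; rewrite tnth2 -sm_termE; apply: h.
by exists t, n, c, k.
Qed.

Lemma cyclic_rot n (c : nterm S n) A (x : 'I_n -> A) k :
  cyclic_term V c -> V A -> teval c x = teval c (x \o rot_ord k).
Proof.
move=> [_ cc] /cc [_ cyc]; elim: k => [|k IH].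
  by apply: teval_ext => i /=; rewrite rot_ord0.
rewrite IH cyc; apply: teval_ext => i /=.
by rewrite ordS_rot rot_ordD add1n.
Qed.

End Generation.

(** * Boolean operations *)

Section TwoValued.
Variable S : signature.
Implicit Types A B : algebra S.

Definition two_val (T : Type) (a b : T) (z : bool) : T := if z then b else a.

(* [true] stands for [b]. *)
Definition acts_as A n (c : nterm S n) (a b : A) (o : {ffun 'I_n -> bool} -> bool) :=
  forall y : {ffun 'I_n -> bool}, teval c (two_val a b \o y) = two_val a b (o y).

Lemma acts_as_expand A n (c : nterm S n) (a b : A) o X
    (s : term (sig1 n) X) (y : X -> bool) :
  acts_as c a b o ->
  teval (expand c s) (two_val a b \o y) = two_val a b (eval (interp1 o) s y).
Proof.
move=> co; elim: s => //= f ts IH; rewrite teval_subst /interp1 -co.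
by apply: teval_ext => i; rewrite /= ffunE.
Qed.

End TwoValued.

Definition join_op n (y : {ffun 'I_n -> bool}) : bool := [exists i, y i].

(** For odd [n] there are no ties, so this operation is self-dual as well as monotone. *)
Definition maj_op n (y : {ffun 'I_n -> bool}) : bool :=
  n < #|[set i | y i]|.*2.

Lemma join_op_eval n (n_gt0 : 0 < n) (X : finType) (s : term (sig1 n) X) :
  exists2 J : {set X}, J != set0 &
    forall y, eval (interp1 (@join_op n)) s y = [exists j in J, y j].
Proof.
elim: s => [x|f ts IH].
  exists [set x] => [|y /=]; first by apply/set0Pn; exists x; rewrite inE.
  apply/idP/existsP => [yx|[j]]; first by exists x; rewrite inE eqxx.
  by rewrite inE => /andP[/eqP ->].
have /choice [J hJ] i : exists J : {set X}, J != set0 /\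
    forall y, eval (interp1 (@join_op n)) (ts i) y = [exists j in J, y j].
  by have [J J0 hJ] := IH i; exists J.
exists (\bigcup_i J i) => [|y /=].
  have [/set0Pn [x xJ] _] := hJ (Ordinal n_gt0).
  by apply/set0Pn; exists x; apply/bigcupP; exists (Ordinal n_gt0).
rewrite /interp1 /join_op; apply/existsP/existsP => [[i]|[j]].
  rewrite ffunE (hJ i).2 => /existsP [j /andP[jJ yj]]; exists j.
  by rewrite yj andbT; apply/bigcupP; exists i.
case/andP=> /bigcupP [i _ jJ] yj; exists i; rewrite ffunE (hJ i).2.
by apply/existsP; exists j; rewrite jJ.
Qed.

Lemma maj_op3 (y : {ffun 'I_3 -> bool}) (i j : 'I_3) :
  i != j -> y i = y j -> maj_op y = y i.
Proof.
move=> ij yij; rewrite /maj_op; case yi: (y i).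
  have : #|[set i; j]| <= #|[set i | y i]|.
    by apply: subset_leq_card; apply/subsetP => k; rewrite !inE => /orP[] /eqP ->; rewrite -?yij.
  by rewrite cards2 ij; case: #|_| => [|[|m]] // _; rewrite !doubleS.
have : #|[set i; j]| <= #|~: [set i | y i]|.
  by apply: subset_leq_card; apply/subsetP => k; rewrite !inE => /orP[] /eqP ->; rewrite -?yij yi.
have := cardsC [set i | y i]; rewrite card_ord cards2 ij.
by case: #|[set i | y i]| => [|[|m]] //; case: #|_| => [|[|l]] //; rewrite !addSn !addnS.
Qed.

Lemma maj_op_compl n (y : {ffun 'I_n -> bool}) :
  odd n -> maj_op [ffun i => ~~ y i] = ~~ maj_op y.
Proof.
move=> odd_n; rewrite /maj_op.
have -> : [set i | [ffun i => ~~ y i] i] = ~: [set i | y i].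
  by apply/setP => i; rewrite !inE ffunE.
have := cardsC [set i | y i]; rewrite card_ord -leqNgt.
move: #|_| #|_| => k l kl; rewrite -{1}kl -addnn ltn_add2r.
rewrite -[in RHS]kl -addnn leq_add2l ltn_neqAle.
by have [e|//] := eqVneq k l; move: odd_n; rewrite -kl e addnn odd_double.
Qed.

Lemma maj_op_mono n (y z : {ffun 'I_n -> bool}) :
  (forall i, y i -> z i) -> maj_op y -> maj_op z.
Proof.
move=> yz /leq_trans; apply; rewrite leq_double; apply: subset_leq_card.
by apply/subsetP => i; rewrite !inE; exact: yz.
Qed.

Lemma maj_op_rot n (y : {ffun 'I_n -> bool}) k :
  maj_op [ffun i => y (rot_ord k i)] = maj_op y.
Proof.
rewrite /maj_op -(card_preimset [set i | y i] (@rot_ord_inj n k)).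
by congr (_ < _.*2); apply: eq_card => i; rewrite !inE ffunE.
Qed.

Lemma maj_op_eval_compl n X (s : term (sig1 n) X) (y : X -> bool) :
  odd n -> eval (interp1 (@maj_op n)) s (fun x => ~~ y x) =
           ~~ eval (interp1 (@maj_op n)) s y.
Proof.
move=> odd_n; elim: s => //= f ts IH; rewrite /interp1 -maj_op_compl //.
by congr maj_op; apply/ffunP => i; rewrite !ffunE IH.
Qed.

Lemma maj_op_eval_mono n X (s : term (sig1 n) X) (y z : X -> bool) :
  (forall x, y x -> z x) ->
  eval (interp1 (@maj_op n)) s y -> eval (interp1 (@maj_op n)) s z.
Proof.
move=> yz; elim: s => [x|f ts IH] /=; first exact: yz.
by apply: maj_op_mono => i; rewrite !ffunE; exact: IH.
Qed.

(* Baker-Pixley interpolation: two majorities always share a coordinate, and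
   three interpolants missing one tuple each are corrected by [maj_op 3]. *)
Lemma maj_op_interpolate n (P : {set {ffun 'I_n -> bool}}) : odd n ->
  exists s : term (sig1 3) 'I_n,
    forall y, y \in P -> eval (interp1 (@maj_op 3)) s y = maj_op y.
Proof.
move=> odd_n; move: {2}_.+1 (ltnSn #|P|) => m.
elim: m P => // m IH P lem.
pose agree (y : {ffun 'I_n -> bool}) := [set i | y i == maj_op y].
have agree_gt y : n < #|agree y|.*2.
  case e: (maj_op y).
    have -> : agree y = [set i | y i] by apply/setP => i; rewrite !inE e eqb_id.
    exact: e.
  have := maj_op_compl y odd_n; rewrite e /maj_op /=.
  have -> // : [set i | [ffun i => ~~ y i] i] = agree y.
  by apply/setP => i; rewrite !inE ffunE e; case: (y i).
have [le2|/card_gt2P [y1 [y2 [y3 [[P1 P2 P3] [n12 n23 n31]]]]]] := leqP #|P| 2.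
  have [y [z hyz]] : exists y z, forall x, x \in P -> x = y \/ x = z.
    have [->|[y yP]] := set_0Vmem P.
      by exists [ffun=> true], [ffun=> true] => x; rewrite inE.
    have [P0|[z]] := set_0Vmem (P :\ y).
      exists y, y => l lP; left; apply/eqP/negPn/negP => li.
      by have := in_set0 l; rewrite -P0 !inE li lP.
    rewrite !inE => /andP[zy zP]; exists y, z => l lP.
    have [->|ly] := eqVneq l y; [by left|right].
    apply/eqP/negPn/negP => lz; move: le2; rewrite leqNgt => /negP; apply.
    by apply/card_gt2P; exists y, z, l; rewrite yP zP lP eq_sym zy eq_sym lz ly.
  have [i] : exists i, i \in agree y :&: agree z.
    apply/set0Pn/negP => /eqP e0.
    have : #|agree y :|: agree z| <= n by rewrite -[X in _ <= X]card_ord max_card.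
    rewrite cardsU e0 cards0 subn0 leqNgt -ltn_double doubleD.
    by rewrite -addnn => /negP; apply; rewrite -addSn leq_add // ltnW.
  rewrite !inE => /andP[/eqP yi /eqP zi]; exists (Var _ i) => x /hyz [] -> //=.
have P_lt x : x \in P -> #|P :\ x| < m.
  by move=> xP; rewrite ltnS in lem; apply: leq_trans lem; rewrite [X in _ < X](cardsD1 x) xP.
have [s1 h1] := IH _ (P_lt _ P1).
have [s2 h2] := IH _ (P_lt _ P2).
have [s3 h3] := IH _ (P_lt _ P3).
pose ss : 3.-tuple (term (sig1 3) 'I_n) := [tuple s1; s2; s3].
exists (@App (sig1 3) _ tt (fun i => tnth ss i)) => y yP /=; rewrite /interp1.
pose k0 : 'I_3 := ord0; pose k1 : 'I_3 := Ordinal (isT : 1 < 3); pose k2 : 'I_3 := ord_max.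
set w := finfun _.
have w0 : y != y1 -> w k0 = maj_op y by move=> ne; rewrite ffunE h1 // !inE ne.
have w1 : y != y2 -> w k1 = maj_op y by move=> ne; rewrite ffunE h2 // !inE ne.
have w2 : y != y3 -> w k2 = maj_op y by move=> ne; rewrite ffunE h3 // !inE ne.
have [e1|ne1] := eqVneq y y1.
  by rewrite (@maj_op3 w k1 k2) ?w1 ?w2 // e1 // eq_sym.
have [e2|ne2] := eqVneq y y2.
  by rewrite (@maj_op3 w k0 k2) ?w0 ?w2 // e2.
by rewrite (@maj_op3 w k0 k1) ?w0 ?w1.
Qed.

(** * Affine algebras *)

Lemma lmod_eval_diff (R : pzRingType) (M : lmodType R) (X : eqType) (Y : Type)
    (t : term (lmod_sig R) (X + Y)) (d : Y -> M) (i : X) (v w : X -> M) (a b : M) :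
  let ev (u : X -> M) := eval (lmod_interp M) t
    (fun z => match z with inl x => u x | inr y => d y end) in
  let upd (u : X -> M) c x := if x == i then c else u x in
  (ev (upd v a) - ev (upd v b) = ev (upd w a) - ev (upd w b))%R.
Proof.
move=> ev upd; rewrite {}/ev {}/upd.
elim: t => [[x|y]|[||| r] ts IH] /=.
- by case: eqP => // _; rewrite !GRing.subrr.
- by rewrite !GRing.subrr.
- by [].
- by rewrite !ffunE -!GRing.opprD IH.
- rewrite !ffunE !GRing.opprD GRing.addrACA [RHS]GRing.addrACA.
  by rewrite (IH ord0) (IH ord_max).
- by rewrite !ffunE -!GRing.scalerBr IH.
Qed.

(** The term condition of abelian algebras: module polynomials are affine maps, so the effect of
    changing one argument is independent of the others. *)
Lemma affine_term_condition (S : signature) (B : algebra S) n (c : nterm S n)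
    (i : 'I_n) (v w : 'I_n -> B) (a b : B) :
  let upd (u : 'I_n -> B) d x := if x == i then d else u x in
  affine B -> teval c (upd v a) = teval c (upd v b) ->
  teval c (upd w a) = teval c (upd w b).
Proof.
move=> upd [R [lmod aff]]; pose M : lmodType R := GRing.Lmodule.Pack lmod.
have [|t ht] := (aff n (fun x : {ffun 'I_n -> B} => teval c x)).1.
  exists (subst c (fun i => Var S (inl i))) => x.
  by rewrite -[RHS]/(teval _ _) teval_subst.
have evE (u : 'I_n -> B) : eval (lmod_interp M) t
    (fun z => match z with inl x => u x | inr y => y end) = teval c u.
  have -> : u = [ffun x => u x] by apply: funext => x; rewrite ffunE.
  by rewrite ht.
have := @lmod_eval_diff R M _ _ t id i v w a b.
rewrite /= !evE => D e; move: D; rewrite -/(upd v a) -/(upd v b) e GRing.subrr.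
by move=> h; exact: (@GRing.subr0_eq M _ _ (esym h)).
Qed.

(** Serves to move the distinguished last argument of a cyclic term to place [j]. *)
Lemma rot_ord_eq n (i j : 'I_n) : (rot_ord j.+1 i == j) = (i.+1 == n).
Proof.
apply/eqP/eqP => [/(congr1 val) /= imod|i1].
  have : i.+1 + j == 0 + j %[mod n] by rewrite addSnnS imod add0n modn_small.
  rewrite eqn_modDr mod0n => /dvdn_leq ni; apply/eqP.
  by rewrite eqn_leq ltn_ord ni.
by apply: val_inj; rewrite /= -addSnnS i1 modnDl modn_small.
Qed.

(** * The edge axioms *)

Section MinimalTaylor.
Variables (S : signature) (G : algebra S).
Hypothesis hG : minimal_taylor G.
Implicit Types A B : algebra S.
Let V := HSPfin G.

Lemma cyclic_term_HSPfin n (c : nterm S n) :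
  0 < n -> (forall x : 'I_n -> G, teval c x = teval c (fun i => x (ordS i))) ->
  cyclic_term V c.
Proof.
move=> n0 cyc; split=> // A VA; split=> x; first exact: teval_idem.
have id : identity G c (subst c (fun i => Var S (ordS i))).
  by move=> v; rewrite teval_subst cyc.
by rewrite (identity_HSPfin VA id) teval_subst.
Qed.

Lemma exists_cyclic_term : exists p (c : nterm S p),
  [/\ 2 < p, odd p & cyclic_term V c].
Proof.
have [p ltp p_prime] := prime_above (maxn #|G| 2).
have [ltGp lt2p] : #|G| < p /\ 2 < p.
  by split; apply: leq_ltn_trans ltp; [exact: leq_maxl|exact: leq_maxr].
have [c cyc] := taylor_cyclic_term p_prime ltGp hG.1.
exists p, c; split=> //; last by apply: cyclic_term_HSPfin; rewrite // prime_gt0.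
by have [p2|//] := even_prime p_prime; rewrite p2 in lt2p.
Qed.

(** The cyclic identity alone defeats projections: for [n > 1] the indices [i] and [ordS i] differ,
    and a valuation singling out variable [i] tells them apart. *)
Lemma cyclic_term_taylor n (c : nterm S n) :
  1 < n -> (forall x : 'I_n -> G, teval c x = teval c (fun i => x (ordS i))) ->
  taylor_term G c.
Proof.
move=> n1 cyc; split; first by move=> x; exact: teval_idem.
pose l : term (sig1 n) nat := @App (sig1 n) nat tt (fun i : 'I_n => Var (sig1 n) (i : nat)).
pose r : term (sig1 n) nat := @App (sig1 n) nat tt (fun i : 'I_n => Var (sig1 n) (ordS i : nat)).
exists 1, (fun=> (l, r)); split=> [_ v|T i [x [y xy]] /(_ ord0)].
  rewrite /= /interp1 (@teval_ext _ _ _ c _ (fun i : 'I_n => v i)); last by move=> i; rewrite ffunE.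
  rewrite cyc; apply: teval_ext => i.
  by rewrite ffunE.
move=> /(_ (fun k => if k == i then x else y)).
rewrite /= /interp1 !ffunE /= eqxx; case: eqP => [e _|_ //].
have := ltn_ord i; rewrite leq_eqVlt => /predU1P[i1|i1].
  by move: e; rewrite i1 modnn => e; rewrite -e in i1; rewrite -i1 in n1.
by move: e; rewrite modn_small // => /esym /n_Sn.
Qed.

Lemma cyclic_term_generates n (c : nterm S n) m (s : nterm S m) :
  1 < n -> cyclic_term V c -> V G -> 0 < m ->
  exists u : nterm (sig1 n) m, forall A, V A -> identity A s (expand c u).
Proof.
move=> n1 [n0 cc] VG m0.
have cyc := (cc G VG).2.
have [u hu] := hG.2 _ _ (cyclic_term_taylor n1 cyc) _ s m0.
exists u => A VA; apply: (identity_HSPfin VA) => x.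
by rewrite teval_expand hu.
Qed.

Lemma HSPfin_refl : V G.
Proof.
have T0 : [set: pow_alg G 1] != set0.
  by have /card_gt0P [x _] := carrier_gt0 (pow_alg G 1); apply/set0Pn; exists x.
have cT : @subuniverse S (pow_alg G 1) setT by move=> f x _; rewrite inE.
pose B := Subalgebra cT T0.
exists 1, B, (fun u : alg_of_sub B => (sval u : {ffun 'I_1 -> G}) ord0); split.
  by move=> f x; rewrite ffunE; congr op; apply/ffunP => i; rewrite !ffunE.
move=> b; have bT : ([ffun=> b] : pow_alg G 1) \in universe B by rewrite inE.
by exists (exist (fun x : pow_alg G 1 => x \in universe B) _ bT); rewrite /= ffunE.
Qed.

(** Convolving [u] with a cyclic term makes it cyclic. On [a] and [b] nothing changes, since all
    shifts of [u] agree there and [c] is idempotent. *)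
Lemma acts_as_symmetrized A n (c u : nterm S n) (a b : A) o :
  acts_as u a b o ->
  (forall (y : {ffun 'I_n -> bool}) k, o [ffun i => y (rot_ord k i)] = o y) ->
  acts_as (convolution c u) a b o.
Proof.
move=> uo osym y; rewrite teval_convolution.
rewrite -[RHS](teval_idem c); apply: teval_ext => k.
rewrite -(osym y k) -uo; apply: teval_ext => i /=.
by rewrite ffunE.
Qed.

Lemma convolution_cyclic n (c u : nterm S n) :
  cyclic_term V c -> cyclic_term V (convolution c u).
Proof.
move=> cc; apply: cyclic_term_HSPfin => [|x]; first by case: cc.
have -> : (fun i => x (ordS i)) = x \o rot_ord 1.
  by apply: funext => i /=; rewrite ordS_rot.
rewrite teval_convolution teval_convolution_rot.
rewrite (cyclic_rot _ 1 cc HSPfin_refl); apply: teval_ext => i; apply: teval_ext => j /=.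
by congr (x _); apply: rot_ord_mod; rewrite modn_mod.
Qed.

(** By minimality every term is a term in [c], so on [a] and [b] it acts as a Boolean term in
    [o]. *)
Lemma acts_as_all A n (c : nterm S n) (a b : A) o m (s : nterm S m) :
  V A -> 1 < n -> 0 < m -> cyclic_term V c -> acts_as c a b o ->
  exists u : nterm (sig1 n) m, forall y : 'I_m -> bool,
    teval s (two_val a b \o y) = two_val a b (eval (interp1 o) u y).
Proof.
move=> VA n1 m0 cc co; have [u hu] := cyclic_term_generates s n1 cc HSPfin_refl m0.
by exists u => y; rewrite (hu A VA) (acts_as_expand _ _ co).
Qed.

Lemma cyclic_boolean A n (c : nterm S n) (a b : A) (psi : ('I_n -> bool) -> bool) :
  V A -> cyclic_term V c -> a <> b ->
  (forall y, teval c (two_val a b \o y) = two_val a b (psi y)) ->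
  forall y k, psi (y \o rot_ord k) = psi y.
Proof.
move=> VA cc ab cpsi y k; have := cyclic_rot (two_val a b \o y) k cc VA.
have -> : (two_val a b \o y) \o rot_ord k = two_val a b \o (y \o rot_ord k) by [].
by rewrite !cpsi; case: (psi y); case: (psi _) => //= e; case: ab.
Qed.

Lemma as_term_digraph A (a b : A) :
  (forall n (c : nterm S n), cyclic_term V c ->
     teval c (fun i => if i.+1 == n then b else a) = b) ->
  as_Z V a b.
Proof. by move=> h n c cc; rewrite h // Sg2_r. Qed.

Lemma sm_term_digraph A (a b : A) :
  (forall n (c : nterm S n) k, cyclic_term V c -> 0 < k -> k.*2 <= n ->
     teval c (fun i => if i < k then a else b) = b) ->
  sm_Z V a b.
Proof.
move=> h t n c k cc k0 kn; rewrite h // tnth2.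
have -> : pair_val b b = fun=> b by apply: funext => z; rewrite /pair_val; case: eqP.
by rewrite teval_idem Sg2_r.
Qed.

(** Every cyclic term acts on [a] and [b] as the join of a nonempty set of variables. In both edge
    conditions the last argument is [b], so it suffices that the last variable occurs in this
    join. *)
Lemma semilattice_strong A (a b : A) (t : nterm S 2) :
  V A -> acts_as_semilattice t a b -> strong (as_Z V) (sm_Z V) a b.
Proof.
move=> VA [taa tbb tab tba].
suff h n (c : nterm S n) (y : 'I_n -> bool) : cyclic_term V c ->
    (forall i : 'I_n, i.+1 = n -> y i) -> teval c (two_val a b \o y) = b.
  split; [apply: as_term_digraph => n c cc|apply: sm_term_digraph => n c k cc k0 kn].
    rewrite -[RHS](h n c (fun i => i.+1 == n) cc) => [|i ->]; last by rewrite eqxx.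
    by apply: teval_ext.
  rewrite -[RHS](h n c (fun i => ~~ (i < k)) cc).
    by apply: teval_ext => i /=; case: ltnP.
  move=> i i1; rewrite -leqNgt -ltnS i1 (leq_trans _ kn) //.
  by rewrite -addnn -addn1 leq_add2l.
have [<-|ab] := pselect (a = b).
  by move=> _ _; apply: teval_diag => i; rewrite /= /two_val; case: ifP.
move=> cc ylast; have n0 : 0 < n by case: cc.
have [p [c0 [p2 p_odd cc0]]] := exists_cyclic_term.
have p0 : 0 < p by apply: ltn_trans p2.
pose u : nterm S p := foldr (fun i s => subst t (pair_val (Var S i) s))
  (Var S (Ordinal p0)) (enum 'I_p).
have uo : acts_as u a b (@join_op p).
  have tj z z' : teval t (pair_val (two_val a b z) (two_val a b z')) = two_val a b (z || z').
    by rewrite -tnth2; case: z; case: z'.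
  move=> z.
  suff : teval u (two_val a b \o z) = two_val a b (has z (enum 'I_p) || z (Ordinal p0)).
    move=> ->; congr two_val; rewrite /join_op.
    apply/orP/existsP => [[/hasP [i _ zi]|z0]|[i zi]]; [by exists i|by exists (Ordinal p0)|].
    by left; apply/hasP; exists i; rewrite ?mem_enum.
  rewrite /u; elim: (enum _) => //= i l IH.
  rewrite teval_subst -orbA -tj -IH; apply: teval_ext => k.
  by rewrite /pair_val; case: eqP.
have sym (z : {ffun 'I_p -> bool}) k : @join_op p [ffun i => z (rot_ord k i)] = join_op z.
  apply/existsP/existsP => [[i]|[i zi]]; first by rewrite ffunE => zi; exists (rot_ord k i).
  have [g gK Kg] := injF_bij (@rot_ord_inj p k).
  by exists (g i); rewrite ffunE Kg.
have ho := acts_as_symmetrized c0 uo sym.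
have [w hw] := acts_as_all c VA (ltnW p2) n0 (convolution_cyclic u cc0) ho.
rewrite hw; have rotw := cyclic_boolean VA cc ab hw.
have [J /set0Pn [j jJ] hJ] := join_op_eval p0 w.
have lt : n.-1 < n by rewrite prednK.
(* Rotating the indicator of [j] into that of the last index shows, by cyclicity, that the last
   index belongs to [J]. *)
have : eval (interp1 (@join_op p)) w (pred1 j).
  by rewrite hJ; apply/existsP; exists j; rewrite jJ /= eqxx.
rewrite -(rotw _ j.+1) hJ => /existsP [i /andP[iJ /eqP ij]].
rewrite hJ; have -> : [exists i0 in J, y i0]; last by [].
apply/existsP; exists i; rewrite iJ; apply: ylast.
by apply/eqP; rewrite -(rot_ord_eq i j) ij.
Qed.

(** Every cyclic term acts on [a] and [b] as a term in a majority operation of odd arity, hence as a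
    monotone self-dual operation, and such a cyclic operation returns [b] when at most half of the
    arguments, forming an initial block, are [a]. *)
Lemma majority_sm A (B : subalgebra A) (a b : A) :
  V A -> has_majority_term (alg_of_sub B) ->
  a \in universe B -> b \in universe B -> sm_Z V a b.
Proof.
move=> VA [m hm] aB bB; apply: sm_term_digraph => n c k cc k0 kn.
have [<-|ab] := pselect (a = b).
  by apply: teval_diag => i; case: ifP.
have n0 : 0 < n by case: cc.
have [p [c0 [p2 p_odd cc0]]] := exists_cyclic_term.
have hmA x y : x \in universe B -> y \in universe B ->
    [/\ teval m (tnth [tuple x; x; y]) = x, teval m (tnth [tuple x; y; x]) = x
      & teval m (tnth [tuple y; x; x]) = x].
  move=> xB yB.
  have valE z1 z2 z3 : val (teval m (tnth [tuple z1; z2; z3]) : alg_of_sub B) =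
      teval m (tnth [tuple val z1; val z2; val z3]).
    rewrite (hom_teval m _ (@sub_val_hom _ _ B)); apply: teval_ext => i.
    by case: i => -[|[|[|i]]] lt.
  pose inB z (zB : z \in universe B) : alg_of_sub B :=
    exist (fun z : A => z \in universe B) z zB.
  have [h1 h2 h3] := hm (inB x xB) (inB y yB).
  by split; [have := congr1 val h1|have := congr1 val h2|have := congr1 val h3]; rewrite valE.
have mo : acts_as m a b (@maj_op 3).
  move=> y; pose f := two_val a b.
  have fB z : f z \in universe B by case: z.
  pose l0 : 'I_3 := ord0; pose l1 : 'I_3 := Ordinal (isT : 1 < 3); pose l2 : 'I_3 := ord_max.
  rewrite (@teval_ext _ _ _ m _ (tnth [tuple f (y l0); f (y l1); f (y l2)])); last first.
    by case=> -[|[|[|i]]] lt //=; congr (f (y _)); apply: val_inj.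
  have [y01|ne01] := eqVneq (y l0) (y l1).
    by rewrite (@maj_op3 y l0 l1) // -y01; case: (hmA (f (y l0)) (f (y l2))).
  have [y02|ne02] := eqVneq (y l0) (y l2).
    by rewrite (@maj_op3 y l0 l2) // -y02; case: (hmA (f (y l0)) (f (y l1))).
  have y12 : y l1 = y l2 by move: ne01 ne02; do 3!case: (y _).
  by rewrite (@maj_op3 y l1 l2) // -y12; case: (hmA (f (y l1)) (f (y l0))).
have [u hu] := maj_op_interpolate setT p_odd.
have uo : acts_as (expand m u) a b (@maj_op p).
  by move=> y; rewrite (acts_as_expand _ _ mo) hu.
have ho := acts_as_symmetrized c0 uo (@maj_op_rot p).
have [w hw] := acts_as_all c VA (ltnW p2) n0 (convolution_cyclic _ cc0) ho.
have rotw := cyclic_boolean VA cc ab hw.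
have kn' : k <= n by apply: leq_trans kn; rewrite -addnn leq_addr.
pose beta j (i : 'I_n) : bool := ~~ (i < j).
have -> : (fun i : 'I_n => if i < k then a else b) = two_val a b \o beta k.
  by apply: funext => i /=; rewrite /beta; case: ltnP.
rewrite hw; case e: (eval _ _ _) => //; exfalso.
(* If [beta k] gave false, its complement would give true; rotated, the complement is
   [beta (n - k)], which lies below [beta k] because [k <= n - k]. Monotonicity then gives a
   contradiction. *)
have : eval (interp1 (@maj_op p)) w (beta (n - k)).
  rewrite -(rotw _ (n - k)).
  have -> : beta (n - k) \o rot_ord (n - k) = fun i => ~~ beta k i.
    apply: funext => i; rewrite /beta /= negbK; have [ik|ki] := ltnP i k.
      rewrite modn_small -?leqNgt ?leq_addl //.
      by rewrite addnBA // ltn_subLR ?ltn_add2r // (leq_trans kn') // leq_addl.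
    have -> : i + (n - k) = i - k + n by rewrite addnBA // addnBAC.
    rewrite modnDr modn_small; last by rewrite (leq_ltn_trans (leq_subr _ _)).
    by rewrite ltn_sub2r // (leq_ltn_trans ki).
  by rewrite maj_op_eval_compl // e.
move=> en; suff : eval (interp1 (@maj_op p)) w (beta k) by rewrite e.
apply: maj_op_eval_mono en => i.
rewrite /beta -!leqNgt; apply: leq_trans.
by rewrite leq_subRL // addnn.
Qed.

(** [phi] is injective: if it identifies [s] and [t], the term condition and cyclicity allow
    replacing [s] by [t] at every place of [c(s, ..., s)], and idempotence yields [s = t]. *)
Lemma affine_as A (B : subalgebra A) (a b : A) :
  V A -> affine (alg_of_sub B) ->
  a \in universe B -> b \in universe B -> as_Z V a b.
Proof.
move=> VA aff aB bB n c cc; have [n0 _] := cc.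
have ltl : n.-1 < n by rewrite prednK.
pose last : 'I_n := Ordinal ltl.
have lastE (i : 'I_n) : (i.+1 == n) = (i == last).
  by rewrite -val_eqE /= -[RHS]eqSS prednK.
pose upd j (w : 'I_n -> alg_of_sub B) d i := if i == j then d else w i.
have rotB k (x : 'I_n -> alg_of_sub B) : teval c x = teval c (x \o rot_ord k).
  have id : identity A c (subst c (fun i => Var S (rot_ord k i))).
    by move=> v; rewrite teval_subst; exact: cyclic_rot cc VA.
  by rewrite (identity_sub id) teval_subst.
pose a' : alg_of_sub B := exist (fun z : A => z \in universe B) a aB.
pose b' : alg_of_sub B := exist (fun z : A => z \in universe B) b bB.
pose phi x := teval c (upd last (fun=> a') x).
have phi_inj : injective phi.
  move=> s t est.
  have TC j (w : 'I_n -> alg_of_sub B) : teval c (upd j w s) = teval c (upd j w t).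
    have updr d : teval c (upd j w d) = teval c (upd last (w \o rot_ord j.+1) d).
      rewrite (rotB j.+1); apply: teval_ext => i.
      by rewrite /= /upd rot_ord_eq lastE.
    by rewrite !updr; apply: (affine_term_condition _ aff est).
  have step k : k <= n -> teval c (fun i : 'I_n => if i < k then t else s) = s.
    elim: k => [_|k IH kn]; first exact: teval_idem.
    rewrite -[RHS]IH; last exact: ltnW.
    pose w (i : 'I_n) := if i < k then t else s.
    have -> : (fun i : 'I_n => if i < k then t else s) = upd (Ordinal kn) w s.
      apply: funext => i; rewrite /upd -val_eqE /= /w.
      by case: eqP => // ->; rewrite ltnn.
    rewrite TC; apply: teval_ext => i; rewrite /upd -val_eqE /= /w ltnS leq_eqVlt.
    by case: eqP.
  by rewrite -(step n (leqnn n)); apply: teval_diag => i; rewrite ltn_ord.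
set d := teval c _.
have dE : d = val (phi b').
  rewrite /phi (hom_teval c _ (@sub_val_hom _ _ B)); apply: teval_ext => i.
  by rewrite /= /upd lastE; case: eqP.
have inSg k : val (iter k phi (phi b')) \in Sg [set a; d].
  elim: k => [|k IH] /=; first by rewrite -dE Sg2_r.
  rewrite {1}/phi (hom_teval c _ (@sub_val_hom _ _ B)).
  apply: subuniverse_teval => [|i]; first exact: Sg_subuniverse.
  by rewrite /= /upd; case: eqP => // _; exact: Sg2_l.
(* An injective map of a finite set is a permutation, so [b'] is an iterate of [phi] at [phi b'],
   and these iterates stay in [Sg [set a; d]]. *)
have := inSg (fingraph.order phi b').-1; rewrite -iterSr prednK ?order_gt0 //.
by rewrite iter_order.
Qed.

(** * The relational axioms *)

Lemma teval_prod A B X (t : term S X) (v : X -> A) (w : X -> B) :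
  @teval S X (prod_alg A B) t (fun x => (v x, w x)) = (teval t v, teval t w).
Proof.
rewrite [teval t _]surjective_pairing.
have h1 : @is_hom S (prod_alg A B) A fst by [].
have h2 : @is_hom S (prod_alg A B) B snd by [].
by rewrite (hom_teval t _ h1) (hom_teval t _ h2).
Qed.

Lemma mem_prod_teval A B (R : subalgebra (prod_alg A B)) X (t : term S X)
    (v : X -> A) (w : X -> B) :
  (forall x, (v x, w x) \in universe R) ->
  (teval t v, teval t w) \in universe R.
Proof.
by move=> h; rewrite -teval_prod; apply: subuniverse_teval => //; exact: universe_closed.
Qed.

Lemma mem_prod2 A B (R : subalgebra (prod_alg A B)) (s : nterm S 2) (a a' : A) (b b' : B) :
  (a, b) \in universe R -> (a', b') \in universe R ->
  (teval s (pair_val a a'), teval s (pair_val b b')) \in universe R.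
Proof.
by move=> h h'; apply: mem_prod_teval => z; rewrite /pair_val; case: eqP.
Qed.

Lemma mem_prod_Sg A B (R : subalgebra (prod_alg A B)) (a : A) (b b1 b2 : B) :
  (a, b1) \in universe R -> (a, b2) \in universe R ->
  b \in Sg [set b1; b2] -> (a, b) \in universe R.
Proof.
move=> h1 h2 /Sg2P [s ->]; have := mem_prod2 s h1 h2.
by rewrite (@teval_diag _ _ _ s a) // => z; rewrite /pair_val; case: eqP.
Qed.

Lemma ordSE n (i : 'I_n) : ordS i = (if i.+1 == n then 0 else i.+1) :> nat.
Proof.
case: eqP => [/= ->|/eqP ne]; first by rewrite modnn.
by rewrite /= modn_small // ltn_neqAle ne ltn_ord.
Qed.

Lemma as_Z_mem (A : algebra S) (a b : A) n (c : nterm S n) :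
  as_Z V a b -> cyclic_term V c ->
  exists s : nterm S 2,
    b = teval s (pair_val a (teval c (fun i => if i.+1 == n then b else a))).
Proof. by move=> ab cc; exact: Sg2P (ab n c cc). Qed.

Lemma sm_Z_mem (A : algebra S) (a b : A) n (c : nterm S n) (t : nterm S 2) k :
  sm_Z V a b -> cyclic_term V c -> 0 < k -> k.*2 <= n ->
  exists s : nterm S 2,
    b = teval s (pair_val a (teval t (pair_val b
          (teval c (fun i => if i < k then a else b))))).
Proof.
move=> ab cc k0 kn; have := ab t n c k cc k0 kn.
by rewrite tnth2 => /Sg2P.
Qed.

(** [c] is applied to one copy of [(a2, b1)] and otherwise [(a1, b2)], giving [(a', b')]. The term
    [s] taking [a1], [a'] to [a2] then puts [(a2, s(b2, b'))] into [R], and the [sm] edge with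
    [t := s] recovers [b2] from [b1] and [s(b2, b')]. *)
Lemma relational1_Z : relational1 V (as_Z V) (sm_Z V).
Proof.
move=> A B VA VB R a1 a2 b1 b2 asa smb h12 h21.
have [p [c [p2 p_odd cc]]] := exists_cyclic_term.
have [s a2E] := as_Z_mem asa cc; set a' := teval c _ in a2E.
have := smb s p c 1 cc isT (ltnW p2); rewrite tnth2; set b' := teval c _.
have h' : (a', b') \in universe R.
  rewrite /b' (cyclic_rot _ 1 cc VB); apply: mem_prod_teval => i /=.
  by rewrite addn1 -[_ %% _]/(nat_of_ord (ordS i)) ordSE; case: eqP.
apply: mem_prod_Sg => //; have := mem_prod2 s h12 h'.
by rewrite -a2E.
Qed.

(** [c] is applied with [a2] and [b2] at adjacent, distinct places, giving [(a', b')]. Both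
    [(a1, b')] and [(a', b')] lie in [R], hence so does [(a2, b')], and [b2] is generated by [b1]
    and [b']. *)
Lemma relational2_Z : relational2 V (as_Z V).
Proof.
move=> A B VA VB R a1 a2 b1 b2 asa asb h11 h12 h21.
have [p [c [p2 p_odd cc]]] := exists_cyclic_term.
have [s a2E] := as_Z_mem asa cc; set a' := teval c _ in a2E.
have := asb p c cc; set b' := teval c _ => b2S.
have h' : (a', b') \in universe R.
  rewrite /b' (cyclic_rot _ 1 cc VB); apply: mem_prod_teval => i /=.
  rewrite addn1 -[_ %% _]/(nat_of_ord (ordS i)) ordSE; case: eqP => [_|//]; last by case: eqP.
  by case: eqP => // e; rewrite -e in p2.
have h1' : (a1, b') \in universe R.
  have := @mem_prod_teval _ _ R _ c (fun=> a1) (fun i => if i.+1 == p then b2 else b1).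
  by rewrite teval_idem; apply=> i; case: eqP.
apply: mem_prod_Sg h21 _ b2S.
have := mem_prod2 s h1' h'.
by rewrite -a2E (@teval_diag _ _ _ s b') // => z; rewrite /pair_val; case: eqP.
Qed.

(** With [p = q.*2.+1], rotations place [a1] at index 0, [b1] at the next [q] indices and [c1] at
    the last [q], so [c] acts on given triples only. The components are then corrected in turn, and
    the term [t] of each later edge absorbs the corrections made before. *)
Lemma relational3_Z : relational3 V (sm_Z V).
Proof.
move=> A B C VA VB VC R a1 a2 b1 b2 c1 c2 sma smb smc h1 h2 h3.
have [p [c [p2 p_odd cc]]] := exists_cyclic_term.
pose q := p./2.
have pq : p = q.*2.+1 by rewrite -[LHS]odd_double_half p_odd.
have q0 : 0 < q by case: (q) pq => // p1; rewrite p1 in p2.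
have q2p : q.*2 <= p by rewrite pq.
have [s a2E] : exists s : nterm S 2, a2 = teval s (pair_val a1
    (teval c (fun i => if i < 1 then a1 else a2))).
  exact: (sm_Z_mem (k := 1) (Var S ord_max) sma cc isT (ltnW p2)).
set a' := teval c _ in a2E.
have [u b2E] := sm_Z_mem s smb cc q0 q2p.
set b' := teval c _ in b2E.
have := smc (subst u (pair_val (Var S ord0) s)) p c q cc q0 q2p.
rewrite tnth2; set c' := teval c _.
have triple X (t : term S X) (x : X -> A) (y : X -> B) (z : X -> C) :
    (forall k, (x k, y k, z k) \in universe R) ->
    (teval t x, teval t y, teval t z) \in universe R.
  by move=> h; rewrite -teval_prod; exact: mem_prod_teval.
have h' : (a', b', c') \in universe R.
  rewrite /b' /c' (cyclic_rot (fun i : 'I_p => if i < q then b1 else b2) p.-1 cc VB).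
  rewrite (cyclic_rot (fun i : 'I_p => if i < q then c1 else c2) q cc VC).
  apply: triple => i /=; have := ltn_ord i.
  move=> ip.
  have -> : ((i + p.-1) %% p < q) = (0 < i <= q).
    have [i0|i1] := posnP i; first by rewrite i0 add0n modn_small; lia.
    have -> : i + p.-1 = i.-1 + p by lia.
    by rewrite modnDr modn_small; lia.
  have -> : ((i + q) %% p < q) = (q < i).
    have [iq|qi] := leqP i q; first by rewrite modn_small; lia.
    have -> : i + q = i - q.+1 + p by lia.
    by rewrite modnDr modn_small; lia.
  rewrite ltnS leqn0 lt0n ltnNge; case: eqP => [->//|_] /=.
  by case: (i <= q).
have h2' : (a2, teval s (pair_val b2 b'), teval s (pair_val c2 c')) \in universe R.
  by rewrite {1}a2E; apply: triple => k; rewrite /pair_val; case: eqP.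
apply: mem_prod_Sg h3 _.
rewrite teval_subst -(@teval_diag _ _ _ u a2 (pair_val a2 a2)); last first.
  by move=> k; rewrite /pair_val; case: eqP.
by rewrite {1}b2E; apply: triple => k; rewrite /pair_val; case: eqP.
Qed.

End MinimalTaylor.

Theorem theorem28 (S : signature) (G : algebra S) (hG : minimal_taylor G) :
  edge_axioms (HSPfin G) (as_Z (HSPfin G)) (sm_Z (HSPfin G)).
Proof.
split.
- by move=> A VA B aff a b; exact: affine_as.
- by move=> A VA B maj a b; exact: majority_sm.
- by move=> A VA a b [t]; exact: semilattice_strong.
- by move=> A B _ _ f hf a b /as_ZE h; apply/as_ZE; exact: term_digraph_hom.
- by move=> A B _ _ f hf a b /sm_ZE h; apply/sm_ZE; exact: term_digraph_hom.
- move=> A B _ _ f hf a b /as_ZE h b' fb' minb'; apply/as_ZE.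
  exact: term_digraph_lift h fb' minb'.
- move=> A B _ _ f hf a b /sm_ZE h b' fb' minb'; apply/sm_ZE.
  exact: term_digraph_lift h fb' minb'.
- move=> A B _ _ f hf a b [/as_ZE h1 /sm_ZE h2] b' fb' minb'.
  by split; [apply/as_ZE; apply: term_digraph_lift h1 fb' minb'
            |apply/sm_ZE; apply: term_digraph_lift h2 fb' minb'].
- exact: relational1_Z.
- exact: relational2_Z.
- exact: relational3_Z.
Qed.
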